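(* Let $q\ge 0$ be real and let $X=(x_i)$, $Y=(y_j)$ be finite alphabets of nonnegative real numbers with $\max\{1,q\}\,x_iy_j<1$ for all $i,j$. Let $\mathbb P_q^{X,Y}$ be the probability measure on pairs $(\mu,\lambda)$ of strict partitions given by $$\mathbb P_q^{X,Y}(\mu,\lambda)=\frac{Q_\mu(qX)Q_{\lambda/\mu}(X)P_\lambda(Y)}{\mathsf H(qX;Y)\mathsf H(X;Y)}\quad\text{if }\mu\subseteq\lambda,$$ and $0$ otherwise. Then the $\lambda$-marginal is $$\mathbb P_q^{X,Y}(\lambda)=\frac{Q_\lambda[X+qX]\,P_\lambda(Y)}{\mathsf H(X+qX;Y)},$$ and the $\mu$-marginal is $$\mathbb P_q^{X,Y}(\mu)=\frac{Q_\mu(qX)\,P_\mu(Y)}{\mathsf H(qX;Y)}.$$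
   Context: $\mu\subseteq\lambda$ means $\mu_i\le\lambda_i$ for all $i$ after appending zeros. For an alphabet $A$, $p_n(A)$ is the $n$-th power sum. $A+B$ denotes the union of alphabets, so $p_n(A+B)=p_n(A)+p_n(B)$; $qX=(qx_i)$; $Q_\lambda[X+qX]$ is $Q_\lambda$ evaluated at the alphabet $X+qX$. Schur $Q$- and $P$-functions are the standard ones (Macdonald, Ch. III.8): with $\sum_{r\ge0}q_r(A)z^r=\prod_{a\in A}\frac{1+az}{1-az}$, one has $Q_{(r)}=q_r$, $Q_{(r,s)}=q_rq_s+2\sum_{i\ge1}(-1)^iq_{r+i}q_{s-i}$ for $r>s\ge0$, and $Q_\lambda$ is the Pfaffian of the skew-symmetric matrix with upper entries $Q_{(\lambda_i,\lambda_j)}$, $i<j$ (a zero part is appended to $\lambda$ if its length is odd); $P_\lambda=2^{-\ell(\lambda)}Q_\lambda$. Skew $Q$-functions are determined by $Q_\lambda(A+B)=\sum_{\mu\subseteq\lambda}Q_{\lambda/\mu}(A)Q_\mu(B)$. $\mathsf H(A;B)=\exp\Big(2\sum_{n\ge1,\ n\text{ odd}}\frac{p_n(A)p_n(B)}{n}\Big)$, which for finite alphabets equals $\prod_{a\in A,b\in B}\frac{1+ab}{1-ab}$. *)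

(* Defs.v *)
From HB Require Import structures.
From mathcomp Require Import all_boot all_order all_algebra all_fingroup.
From mathcomp Require Import all_classical all_reals all_analysis.

Set Implicit Arguments.
Unset Strict Implicit.
Unset Printing Implicit Defensive.

Import Order.TTheory GRing.Theory Num.Theory.
Import numFieldNormedType.Exports.

Local Open Scope classical_set_scope.
Local Open Scope ring_scope.

Definition is_strict_partition (s : seq nat) : bool :=
  sorted gtn s && (0%N \notin s).

Record strict_partition := StrictPartition {
  parts :> seq nat;
  partsP : is_strict_partition parts }.

HB.instance Definition _ := [isSub for parts].
HB.instance Definition _ := [Countable of strict_partition by <:].

Definition part_sub (mu lam : seq nat) : Prop :=
  forall i : nat, (nth 0 mu i <= nth 0 lam i)%N.

Section Pfaffian.
Variable K : fieldType.

Lemma pf_even_subproof m (i : 'I_m) : (i.*2 < m.*2)%N.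
Proof. by rewrite ltn_double. Qed.

Lemma pf_odd_subproof m (i : 'I_m) : (i.*2.+1 < m.*2)%N.
Proof. by rewrite ltn_Sdouble. Qed.

Definition pfaffian m (M : 'M[K]_(m.*2)) : K :=
  (2 ^+ m * m`!%:R)^-1 *
  \sum_(s : 'S_(m.*2)) (-1) ^+ s *
    \prod_(i < m) M (s (Ordinal (pf_even_subproof i)))
                    (s (Ordinal (pf_odd_subproof i))).

End Pfaffian.

(* A finite alphabet is a sequence of scalars; union is concatenation [++]. *)
Section SchurQ.
Variable K : fieldType.
Implicit Types (A B : seq K) (r s : nat) (lam mu : seq nat).

(* Coefficient of z^r in (1 + az)/(1 - az) = 1 + 2az + 2a^2z^2 + ... *)
Definition q1_coef (a : K) r : K := if r is 0 then 1 else 2 * a ^+ r.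

Fixpoint q_row A r : K :=
  if A is a :: A' then \sum_(i < r.+1) q1_coef a i * q_row A' (r - i)
  else (r == 0)%:R.

(* The terms of index i > s vanish, as q_{s-i} = 0 there. *)
Definition Q2 A r s : K :=
  q_row A r * q_row A s +
  2 * \sum_(1 <= i < s.+1) (-1) ^+ i * q_row A (r + i) * q_row A (s - i).

(* [uphalf n] is n/2 rounded up, so [nth 0] supplies the zero part that is
   appended when the length is odd. *)
Definition schurQ lam A : K :=
  pfaffian (\matrix_(i < (uphalf (size lam)).*2, j < (uphalf (size lam)).*2)
    if (i < j)%N then Q2 A (nth 0%N lam i) (nth 0%N lam j)
    else if (j < i)%N then - Q2 A (nth 0%N lam j) (nth 0%N lam i)
    else 0).

Definition schurP lam A : K := (2 ^+ size lam)^-1 * schurQ lam A.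

(* The condition outside the range mu <= lam only normalizes the family, so
   that it is unique. *)
Definition is_skew_schurQ
    (S : strict_partition -> strict_partition -> seq K -> K) : Prop :=
  (forall (lam : strict_partition) A B,
    schurQ lam (A ++ B) =
    \sum_(mu \in [set mu : strict_partition | part_sub mu lam])
      S lam mu A * schurQ mu B) /\
  (forall (lam mu : strict_partition) A, ~ part_sub mu lam -> S lam mu A = 0).

(* [skew_schurQ lam mu A] is Q_{lam/mu}(A). The constant 0 is the default that
   [xget] requires; it plays no role since a family as above exists. *)
Definition skew_schurQ : strict_partition -> strict_partition -> seq K -> K :=
  xget (fun _ _ _ => 0) [set S | is_skew_schurQ S].

Definition powersum (n : nat) A : K := \sum_(a <- A) a ^+ n.

Definition dilate (c : K) A : seq K := [seq c * a | a <- A].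

(* q_row is given by the generating series of the product over a in A of
   (1 + az)/(1 - az), here with denominators cleared. *)
Lemma q_row_gen A n :
  \sum_(i < n.+1) q_row A i * (\prod_(a <- A) (1 - a *: 'X))`_(n - i) =
  (\prod_(a <- A) (1 + a *: 'X))`_n.
Proof.
pose T N (f : nat -> K) : {poly K} := \poly_(i < N) f i.
have eqM N (p p' r r' : {poly K}) : (forall i, (i < N)%N -> p`_i = p'`_i) ->
    (forall i, (i < N)%N -> r`_i = r'`_i) ->
    forall i, (i < N)%N -> (p * r)`_i = (p' * r')`_i.
  move=> Hp Hr i iN; rewrite !coefM; apply: eq_bigr => j _.
  rewrite Hp ?Hr //; first by apply: leq_ltn_trans iN; rewrite leq_subr.
  by apply: leq_ltn_trans iN; rewrite -ltnS.
suff key N : forall i, (i < N)%N ->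
    (T N (q_row A) * \prod_(a <- A) (1 - a *: 'X))`_i =
    (\prod_(a <- A) (1 + a *: 'X))`_i.
  rewrite -(key n.+1) // coefM; apply: eq_bigr => i _.
  by rewrite coef_poly ltn_ord.
elim: A => [|a A IH] i iN.
  by rewrite !big_nil mulr1 coef_poly iN coef1.
rewrite !big_cons.
have H1 j : (j < N)%N ->
    (T N (q_row (a :: A)))`_j = (T N (q1_coef a) * T N (q_row A))`_j.
  move=> jN; rewrite coef_poly jN coefM; apply: eq_bigr => k _.
  have kN : (k < N)%N by apply: leq_ltn_trans jN; rewrite -ltnS.
  have jkN : (j - k < N)%N by apply: leq_ltn_trans jN; rewrite leq_subr.
  by rewrite !coef_poly kN jkN.
have H2 j : (j < N)%N -> (T N (q1_coef a) * (1 - a *: 'X))`_j =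
    (1 + a *: 'X : {poly K})`_j.
  move=> jN; rewrite mulrBr mulr1 -scalerAr coefB coefZ coefMX coefD coefZ.
  rewrite coef1 coefX coef_poly jN.
  case: j jN => [|j] jN /=; first by rewrite !mulr0 subr0 addr0.
  rewrite coef_poly (ltnW jN) add0r.
  case: j jN => [|j] jN /=.
    by rewrite expr1 mulr1 mulrDl mul1r addrK.
  by rewrite mulr0 exprS mulrCA subrr.
rewrite (eqM N _ _ _ _ H1 (fun _ _ => erefl) i iN) mulrACA.
exact: (eqM N _ _ _ _ H2 IH i iN).
Qed.

End SchurQ.

Section Measure.
Variable R : realType.
Implicit Types (A B X Y : seq R).

Definition H_kernel A B : R :=
  expR (2 * \big[+%R/0]_(1 <= n <oo | odd n)
              (powersum n A * powersum n B / n%:R)).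

Definition weight (q : R) X Y (mu lam : strict_partition) : R :=
  if `[< part_sub mu lam >] then
    schurQ mu (dilate q X) * skew_schurQ lam mu X * schurP lam Y /
    (H_kernel (dilate q X) Y * H_kernel X Y)
  else 0.

End Measure.

(* [esum] is the supremum of the finite partial sums, which is the value of the
   sum because the terms are required to be nonnegative. *)
Definition is_prob_mass (R : realType) (T : choiceType) (w : T -> R) : Prop :=
  (forall t, 0 <= w t) /\ (\esum_(t in [set: T]) (w t)%:E = 1)%E.

(* The sum in [is_skew_schurQ] is over a finite set, so that [\sum_(_ \in _)]
   is the ordinary sum. *)
Lemma finite_part_sub (lam : strict_partition) :
  finite_set [set mu : strict_partition | part_sub mu lam].
Proof.
pose n := size lam; pose M := (\max_(x <- lam) x)%N.
pose f (mu : strict_partition) : {ffun 'I_n -> 'I_M.+1} :=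
  [ffun i : 'I_n => inord (nth 0%N mu i)].
have leM i : (nth 0%N lam i <= M)%N.
  have [ilt|ige] := ltnP i (size lam); last by rewrite nth_default.
  by exact: (@leq_bigmax_seq nat lam xpredT id _ (mem_nth _ ilt)).
have szle (mu : strict_partition) : part_sub mu lam -> (size mu <= n)%N.
  move=> sub; rewrite leqNgt; apply/negP => lt.
  have := sub n; rewrite [X in (_ <= X)%N]nth_default // leqn0 => /eqP e0.
  by have /andP[_ /negP] := partsP mu; apply; rewrite -e0 mem_nth.
have finj : {in [set mu : strict_partition | part_sub mu lam] &, injective f}.
  move=> mu nu; rewrite !inE /= => smu snu /ffunP efg.
  have enth i : nth 0%N mu i = nth 0%N nu i.
    have [ilt|ige] := ltnP i n; last first.
      by rewrite !nth_default // (leq_trans _ ige) ?szle.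
    have := congr1 val (efg (Ordinal ilt)); rewrite !ffunE /= !inordK //.
    - by rewrite ltnS (leq_trans (snu i)).
    - by rewrite ltnS (leq_trans (smu i)).
  have szge (a b : strict_partition) :
      (forall i, nth 0%N a i = nth 0%N b i) -> (size a <= size b)%N.
    move=> eab; rewrite leqNgt; apply/negP => lt.
    have /andP[_ /negP] := partsP a; apply.
    by rewrite -[0%N](nth_default 0%N (leqnn (size b))) -eab mem_nth.
  apply: val_inj; apply: (@eq_from_nth _ 0%N) => [|i _ /=]; last exact: enth.
  by apply/eqP; rewrite eqn_leq !szge.
by rewrite -(eq_finite_set (inj_card_eq finj)); exact: finite_finset.
Qed.

(* Main.v *)
Require Import Defs.
From mathcomp Require Import all_boot all_order all_algebra all_fingroup.
From mathcomp Require Import all_classical all_reals all_analysis.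
From mathcomp Require Import ring lra zify.

Import Order.TTheory GRing.Theory Num.Theory.
Import numFieldNormedType.Exports.
Local Open Scope classical_set_scope.
Local Open Scope ring_scope.

Set Implicit Arguments.
Unset Strict Implicit.
Unset Printing Implicit Defensive.

(** The whole statement follows from two properties of the skew functions. The
    defining expansion of Q_lam(A + B) gives the lam-marginal at once, since H
    is multiplicative in its first argument. The skew Cauchy identity
      sum_lam Q_{lam/mu}(X) P_lam(Y) = H(X; Y) P_mu(Y)
    gives the mu-marginal, and, for mu empty and the alphabet qX, the total
    mass 1. What has to be done is to get from the Pfaffian definition to an
    explicit nonnegative formula for Q_{lam/mu}, and to prove the skew Cauchy
    identity for that formula.

    Adding one variable x to an alphabet multiplies q(z) by (1 + xz)/(1 - xz),
    which makes Q_lam(x, B) the Pfaffian of a Gram matrix of vectors t_i, each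
    of them a combination of vectors e_j, j <= i, whose Gram Pfaffians are the
    Q_mu(B). Multilinearity and alternation expand it into the Q_mu(B) with lam
    and mu interlacing (gram_pf_branching, schurQ_branching). The coefficient
    is a product of local weights, read along the sites k, ..., 1 with a carry
    in {0, 1} (strip_weight). Iterating over the variables of X produces
    nonnegative skew functions skewQ; they are the only ones, because the Q_mu
    are linearly independent (schurQ_free): the term of highest degree in x of
    Q_mu(x, B) is 2 x^k Q_mu'(B), where mu' is mu without its largest part k.

    Because the weights are local, the sums over lam and over tau in
      sum_lam Q_{lam/mu}(x) P_{lam/nu}(y) =
        (1 + xy)/(1 - xy) sum_tau Q_{nu/tau}(x) P_{mu/tau}(y)
    are products of 4 x 4 transfer matrices, one for each site, and a single
    matrix intertwines them at all sites (up_down_intertwine). Summing over the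
    unbounded part of lam gives the factor (strip_commute). Moving the strips
    of X through those of Y, one variable at a time, gives the skew Cauchy
    identity (skew_cauchy) with the product of the (1 + xy)/(1 - xy), which is
    H(X; Y) by the power series of ln ((1 + p)/(1 - p)) (H_kernelE). All terms
    are nonnegative, so that the infinite sums can be exchanged freely. *)

(** * Pfaffians *)

Section PfaffianTheory.
Variable K : numFieldType.

Definition even_pos m (i : 'I_m) : 'I_(m.*2) := Ordinal (pf_even_subproof i).
Definition odd_pos m (i : 'I_m) : 'I_(m.*2) := Ordinal (pf_odd_subproof i).

Lemma pos_split m (j : 'I_(m.*2)) :
  exists i : 'I_m, j = even_pos i \/ j = odd_pos i.
Proof.
have jm : (j./2 < m)%N by have := ltn_ord j; lia.
exists (Ordinal jm); case: (boolP (odd j)) => oj; [right|left];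
  by apply: val_inj => /=; lia.
Qed.

Lemma pos_neq m (i k : 'I_m) :
  [/\ even_pos i != odd_pos k, (even_pos i == even_pos k) = (i == k)
    & (odd_pos i == odd_pos k) = (i == k)].
Proof. by rewrite -!val_eqE /=; split; lia. Qed.

Definition pf_term m (M : 'M[K]_(m.*2)) (s : 'S_(m.*2)) : K :=
  (-1) ^+ s * \prod_(i < m) M (s (even_pos i)) (s (odd_pos i)).

Lemma pfaffianE m (M : 'M[K]_(m.*2)) :
  pfaffian M = (2 ^+ m * m`!%:R)^-1 * \sum_s pf_term M s.
Proof. by []. Qed.

Lemma pfaffian_perm m (M : 'M[K]_(m.*2)) (t : 'S_(m.*2)) :
  pfaffian (\matrix_(i, j) M (t i) (t j)) = (-1) ^+ t * pfaffian M.
Proof.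
rewrite !pfaffianE mulrCA; congr (_ * _); rewrite mulr_sumr.
rewrite [RHS](reindex_inj (mulIg t)) /=; apply: eq_bigr => s _.
rewrite /pf_term odd_permM signr_addb !mulrA; congr (_ * _).
  by rewrite mulrAC -signr_addb addbb mul1r.
by apply: eq_bigr => i _; rewrite mxE !permM.
Qed.

(** Exchanging k and l fixes M but changes the sign of the Pfaffian. *)
Lemma pfaffian_alternating m (M : 'M[K]_(m.*2)) (k l : 'I_(m.*2)) :
  k != l -> (forall i j, M (tperm k l i) (tperm k l j) = M i j) ->
  pfaffian M = 0.
Proof.
move=> kl sym; have := pfaffian_perm M (tperm k l).
rewrite odd_tperm kl expr1 mulN1r.
rewrite (_ : \matrix_(i, j) _ = M); last by apply/matrixP => i j; rewrite mxE.
by move/eqP; rewrite -addr_eq0 -mulr2n mulrn_eq0 /= => /eqP.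
Qed.

(** Each term of the Pfaffian has exactly one factor that meets the index k. *)
Lemma pfaffian_linear m (A B C : 'M[K]_(m.*2)) (k : 'I_(m.*2)) (a : K) :
  (forall i j, i != k -> j != k -> A i j = B i j /\ A i j = C i j) ->
  (forall j, j != k -> A k j = a * B k j + C k j) ->
  (forall i, i != k -> A i k = a * B i k + C i k) ->
  pfaffian A = a * pfaffian B + pfaffian C.
Proof.
move=> same row col; rewrite !pfaffianE mulrCA -mulrDr; congr (_ * _).
rewrite mulr_sumr -big_split /=; apply: eq_bigr => s _.
rewrite /pf_term mulrCA -mulrDr; congr (_ * _).
have [i0 Hi0] := pos_split (s^-1%g k).
have sk j : (s j == k) = (j == s^-1%g k) by apply/eqP/eqP => [<-|->]; rewrite ?permK ?permKV.
have other i : i != i0 -> s (even_pos i) != k /\ s (odd_pos i) != k.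
  move=> ii0; rewrite !sk; have [n1 n2 n3] := pos_neq i i0.
  have [n4 _ _] := pos_neq i0 i.
  by case: Hi0 => ->; rewrite ?n2 ?n3 ?ii0 ?n1 // eq_sym n4.
have D1 F : \prod_(i < m) F i = F i0 * \prod_(i < m | i != i0) F i :> K.
  by rewrite (bigD1 i0).
rewrite !D1 mulrA.
have -> : \prod_(i < m | i != i0) B (s (even_pos i)) (s (odd_pos i)) =
          \prod_(i < m | i != i0) A (s (even_pos i)) (s (odd_pos i)).
  by apply: eq_bigr => i /other[h1 h2]; have [-> _] := same _ _ h1 h2.
have -> : \prod_(i < m | i != i0) C (s (even_pos i)) (s (odd_pos i)) =
          \prod_(i < m | i != i0) A (s (even_pos i)) (s (odd_pos i)).
  by apply: eq_bigr => i /other[h1 h2]; have [_ ->] := same _ _ h1 h2.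
rewrite -mulrDl; congr (_ * _).
have [n1 _ _] := pos_neq i0 i0.
case: Hi0 => H.
  have -> : s (even_pos i0) = k by rewrite -H permKV.
  by apply: row; rewrite sk H eq_sym.
have -> : s (odd_pos i0) = k by rewrite -H permKV.
by apply: col; rewrite sk H.
Qed.

(** The pairs are unordered and, M being skew, so are the members of a pair. *)
Lemma pf_term_swap m (M : 'M[K]_(m.*2)) (i : 'I_m) (s : 'S_(m.*2)) :
  (forall i j, M i j = - M j i) ->
  pf_term M (tperm (even_pos i) (odd_pos i) * s) = pf_term M s.
Proof.
move=> skew; rewrite /pf_term odd_mul_tperm.
have [n1 _ _] := pos_neq i i; rewrite n1 /= signrN mulNr -mulrN; congr (_ * _).
have D1 F : \prod_(k < m) F k = F i * \prod_(k < m | k != i) F k :> K.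
  by rewrite (bigD1 i).
rewrite !D1 !permM tpermL tpermR skew mulNr opprK; congr (_ * _).
apply: eq_bigr => k ki; have [n2 n3 n4] := pos_neq i k.
have [n5 _ _] := pos_neq k i.
by rewrite !permM !tpermD ?n2 ?n3 ?n4 // eq_sym.
Qed.

Lemma pf_term_pair_swap m (M : 'M[K]_(m.*2)) (i k : 'I_m) (s : 'S_(m.*2)) :
  pf_term M (tperm (even_pos i) (even_pos k) * (tperm (odd_pos i) (odd_pos k) * s))
  = pf_term M s.
Proof.
rewrite /pf_term !odd_mul_tperm.
have [_ -> ->] := pos_neq i k; rewrite addbA addbb; congr (_ * _).
rewrite [RHS](reindex_inj (@perm_inj _ (tperm i k))) /=; apply: eq_bigr => j _.
rewrite !permM.
have ev : tperm (even_pos i) (even_pos k) (even_pos j) = even_pos (tperm i k j).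
  have [_ n1 _] := pos_neq i j; have [_ n2 _] := pos_neq k j.
  case: (tpermP i k j) => [->|->|/eqP h1 /eqP h2]; rewrite ?tpermL ?tpermR //.
  by rewrite tpermD // ?n1 ?n2 eq_sym.
have od : tperm (odd_pos i) (odd_pos k) (odd_pos j) = odd_pos (tperm i k j).
  have [_ _ n1] := pos_neq i j; have [_ _ n2] := pos_neq k j.
  case: (tpermP i k j) => [->|->|/eqP h1 /eqP h2]; rewrite ?tpermL ?tpermR //.
  by rewrite tpermD // ?n1 ?n2 eq_sym.
have evo l : tperm (odd_pos i) (odd_pos k) (even_pos l) = even_pos l.
  by have [n1 _ _] := pos_neq l i; have [n2 _ _] := pos_neq l k; rewrite tpermD // eq_sym.
have odo l : tperm (even_pos i) (even_pos k) (odd_pos l) = odd_pos l.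
  by have [n1 _ _] := pos_neq i l; have [n2 _ _] := pos_neq k l; rewrite tpermD.
by rewrite ev odo evo od.
Qed.

Lemma sum_perm_fix_max n (F : 'S_n.+1 -> K) :
  \sum_(s : 'S_n.+1 | s ord_max == ord_max) F s =
  \sum_(s : 'S_n) F (lift_perm ord_max ord_max s).
Proof.
rewrite (reindex (lift_perm ord_max ord_max)) /=; last first.
  pose f (s : 'S_n.+1) k := odflt k (unlift (s ord_max) (s (lift ord_max k))).
  have fK (s : 'S_n.+1) k : lift (s ord_max) (f s k) = s (lift ord_max k).
    rewrite /f; have:= neq_lift ord_max k.
    by rewrite -(can_eq (permK s)) => /unlift_some[] ? ? ->.
  have f_inj s : injective (f s).
    move=> k l; move/(congr1 (lift (s ord_max))); rewrite !fK.
    by move/perm_inj/lift_inj.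
  exists (fun s => perm (f_inj s)) => [s _ | s].
    apply/permP=> k; rewrite permE; apply: (@lift_inj _ (lift_perm ord_max ord_max s ord_max)).
    by rewrite fK lift_perm_lift lift_perm_id.
  move/(s _ =P _) => s0; apply/permP=> k.
  case: (unliftP ord_max k) => [k'|] ->; rewrite ?lift_perm_id //.
  by rewrite lift_perm_lift permE -(fK s) s0.
by apply: eq_bigl => s; rewrite lift_perm_id eqxx.
Qed.

(** The 2m+2 positions at which a permutation can put the last index all
    contribute the same, and the last index can only be paired with the one
    before it. *)
Lemma pfaffian_last m (M : 'M[K]_(m.+1.*2)) (N : 'M[K]_(m.*2)) :
  (forall i j, M i j = - M j i) ->
  (forall i j, N i j = M (lift ord_max (lift ord_max i)) (lift ord_max (lift ord_max j))) ->
  (forall i, M (lift ord_max (lift ord_max i)) ord_max = 0) ->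
  M (lift ord_max ord_max) ord_max = 1 ->
  pfaffian M = pfaffian N.
Proof.
move=> skew NE M0 M1.
have evm : even_pos (ord_max : 'I_m.+1) = lift ord_max ord_max.
  by apply: val_inj; rewrite /= /bump ltnn.
have odm : odd_pos (ord_max : 'I_m.+1) = ord_max by apply: val_inj.
have pos_eq j : \sum_(s : 'S_(m.+1.*2) | s j == ord_max) pf_term M s =
    \sum_(s : 'S_(m.+1.*2) | s ord_max == ord_max) pf_term M s.
  have odd_eq i :
      \sum_(s : 'S_(m.+1.*2) | s (odd_pos i) == ord_max) pf_term M s =
      \sum_(s : 'S_(m.+1.*2) | s ord_max == ord_max) pf_term M s.
    set t := (tperm (even_pos i) (even_pos ord_max) *
              tperm (odd_pos i) (odd_pos ord_max))%g.
    rewrite (reindex_inj (mulgI t)) /=; apply: eq_big => s.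
      have [n1 _ _] := pos_neq i i; have [n2 _ _] := pos_neq ord_max i.
      by rewrite /t !permM (tpermD n1 n2) tpermL odm.
    by rewrite /t -mulgA pf_term_pair_swap.
  have [i [->|->]] := pos_split j; last exact: odd_eq.
  rewrite (reindex_inj (mulgI (tperm (even_pos i) (odd_pos i)))) /=.
  rewrite -(odd_eq i); apply: eq_big => s; first by rewrite permM tpermL.
  by rewrite pf_term_swap.
have -> : pfaffian M = (2 ^+ m.+1 * m.+1`!%:R)^-1 *
   ((m.+1.*2)%:R * \sum_(s : 'S_(m.+1.*2) | s ord_max == ord_max) pf_term M s).
  rewrite pfaffianE; congr (_ * _).
  rewrite (partition_big (fun s : 'S_(m.+1.*2) => s^-1%g ord_max) predT) //=.
  under eq_bigr => j _.
    rewrite (eq_bigl (fun s : 'S_(m.+1.*2) => s j == ord_max)); last first.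
      by move=> s; apply/eqP/eqP => [<-|<-]; rewrite ?permK ?permKV.
    rewrite pos_eq; over.
  by rewrite sumr_const cardT size_enum_ord mulr_natl.
rewrite sum_perm_fix_max.
have -> : \sum_(s : 'S_(m.*2).+1) pf_term M (lift_perm ord_max ord_max s) =
          \sum_(s : 'S_(m.*2).+1 | s ord_max == ord_max)
            pf_term M (lift_perm ord_max ord_max s).
  rewrite [RHS]big_mkcond /=; apply: eq_bigr => s _; case: ifPn => // sm.
  rewrite /pf_term (bigD1 ord_max) //= evm odm lift_perm_lift lift_perm_id.
  case: (unliftP ord_max (s ord_max)) sm => [k|] ->; last by rewrite eqxx.
  by rewrite M0 mul0r mulr0.
rewrite sum_perm_fix_max.
have -> : \sum_(s : 'S_(m.*2)) pf_term M (lift_perm ord_max ord_max (lift_perm ord_max ord_max s))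
  = \sum_s pf_term N s.
  apply: eq_bigr => s _; rewrite /pf_term !odd_lift_perm /= !addbb /=; congr (_ * _).
  rewrite (bigD1 ord_max) //= evm odm lift_perm_lift !lift_perm_id M1 mul1r.
  rewrite big_mkcond big_ord_recr /= eqxx mulr1; apply: eq_bigr => i _.
  have lt := ltn_ord i.
  rewrite ifT; last by rewrite -val_eqE /=; lia.
  have -> : even_pos (widen_ord (leqnSn m) i) = lift ord_max (lift ord_max (even_pos i)).
    by apply: ord_inj; rewrite !lift_max.
  have -> : odd_pos (widen_ord (leqnSn m) i) = lift ord_max (lift ord_max (odd_pos i)).
    by apply: ord_inj; rewrite !lift_max.
  by rewrite !lift_perm_lift NE.
rewrite pfaffianE mulrA; congr (_ * _).
rewrite factS natrM exprS -mul2n natrM.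
have h1 : (m`!%:R : K) != 0 by rewrite pnatr_eq0 -lt0n fact_gt0.
have h2 : (m.+1%:R : K) != 0 by rewrite pnatr_eq0.
have h3 : (2 ^+ m : K) != 0 by rewrite expf_neq0 // pnatr_eq0.
by field; rewrite h1 h3 addrC natr1 h2.
Qed.

End PfaffianTheory.

(** * Pfaffians of Gram matrices *)

Section GramPfaffian.
Variables (K : numFieldType) (V : lmodType K) (beta : V -> V -> K).
Hypothesis beta_linearl : forall a u v w,
  beta (a *: u + v) w = a * beta u w + beta v w.
Hypothesis beta_skew : forall u v, beta u v = - beta v u.

Lemma beta_linearr a u v w : beta w (a *: u + v) = a * beta w u + beta w v.
Proof.
by rewrite beta_skew beta_linearl opprD -mulrN -!beta_skew.
Qed.

Definition gram_pf_size m (d : V) (l : seq V) : K :=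
  pfaffian (\matrix_(i < m.*2, j < m.*2) beta (nth d l i) (nth d l j)).

(** A list of odd size is completed by d, as a partition of odd length is
    completed by a zero part in schurQ. *)
Definition gram_pf (d : V) (l : seq V) : K := gram_pf_size (uphalf (size l)) d l.

Lemma size_le_uphalf n : (n <= (uphalf n).*2)%N.
Proof. by rewrite uphalf_half; have := odd_double_half n; case: odd => /=; lia. Qed.

Lemma nth_cat_cons (T : Type) (d u u' : T) p l i :
  nth d (p ++ u :: l) i =
  if i == size p then u else nth d (p ++ u' :: l) i.
Proof.
rewrite !nth_cat; case: ltngtP => // h; last by rewrite h subnn.
by case E: (i - size p)%N => [|k] //; move: h; rewrite -subn_gt0 E.
Qed.

Lemma gram_pf_linear d p a u v l :
  gram_pf d (p ++ (a *: u + v) :: l) =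
  a * gram_pf d (p ++ u :: l) + gram_pf d (p ++ v :: l).
Proof.
rewrite /gram_pf !size_cat /= /gram_pf_size.
set m := uphalf _.
have pm : (size p < m.*2)%N.
  by apply: leq_trans (size_le_uphalf _); rewrite addnS ltnS leq_addr.
have nthp w : nth d (p ++ w :: l) (size p) = w by rewrite nth_cat ltnn subnn.
pose c k := nth d (p ++ 0 :: l) k.
have nthj w k : (k == size p) = false -> nth d (p ++ w :: l) k = c k.
  by move=> kp; rewrite (nth_cat_cons d w 0) kp.
apply: (@pfaffian_linear _ m _ _ _ (Ordinal pm)) => [i j|j|j]; rewrite -!val_eqE /=.
- by move=> /negbTE ip /negbTE jp; rewrite !mxE /= !nthj.
- by move=> /negbTE jp; rewrite !mxE /= !nthp !nthj // beta_linearl.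
- by move=> /negbTE jp; rewrite !mxE /= !nthp !nthj // beta_linearr.
Qed.

Lemma gram_pf_alternating d p u l : gram_pf d (p ++ u :: u :: l) = 0.
Proof.
rewrite /gram_pf size_cat /= /gram_pf_size.
set m := uphalf _.
have pm : (size p < m.*2)%N.
  by apply: leq_trans (size_le_uphalf _); rewrite addnS ltnS leq_addr.
have pm1 : ((size p).+1 < m.*2)%N.
  by apply: leq_trans (size_le_uphalf _); rewrite !addnS !ltnS leq_addr.
have swap (i : 'I_(m.*2)) :
    nth d (p ++ u :: u :: l) (tperm (Ordinal pm) (Ordinal pm1) i) =
    nth d (p ++ u :: u :: l) i.
  by case: tpermP => [->|->|_ _] //=; rewrite !nth_cat ltnn subnn ltnNge leqnSn /= subSnn.
apply: (@pfaffian_alternating _ m _ (Ordinal pm) (Ordinal pm1)).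
  by rewrite -val_eqE /=; lia.
by move=> i j; rewrite !mxE !swap.
Qed.

Lemma gram_pf_linearZ d p a u l :
  gram_pf d (p ++ (a *: u) :: l) = a * gram_pf d (p ++ u :: l).
Proof.
have h0 : gram_pf d (p ++ 0 :: l) = 0.
  have := gram_pf_linear d p 1 0 0 l; rewrite scale1r addr0 mul1r.
  by move/eqP; rewrite addrC -subr_eq subrr => /eqP <-.
by rewrite -[a *: u]addr0 gram_pf_linear h0 addr0.
Qed.

(** If p has odd size, e takes the place of the padding vector d, with which it
    agrees on p. If p has even size, e and the padding d are both added; d may
    be replaced with d - e, which is orthogonal to p, so that pfaffian_last
    applies. *)
Lemma gram_pf_rcons d p e :
  (forall v, v \in p -> beta v e = beta v d) -> beta e d = 1 ->
  gram_pf d (p ++ [:: e]) = gram_pf d p.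
Proof.
move=> ped ed.
have bvv v : beta v v = 0.
  by apply/eqP; rewrite -[_ == 0](mulrn_eq0 (beta v v) 2) mulr2n {1}beta_skew addNr.
have sz : size (p ++ [:: e]) = (size p).+1 by rewrite size_cat addn1.
case: (boolP (odd (size p))) => op.
  rewrite /gram_pf sz.
  have -> : uphalf (size p).+1 = uphalf (size p).
    by rewrite !uphalf_half /= op; lia.
  rewrite /gram_pf_size; congr pfaffian; apply/matrixP => i j; rewrite !mxE.
  have nthE k : nth d (p ++ [:: e]) k = if k == size p then e else nth d p k.
    rewrite nth_cat; case: ltngtP => // h; last by rewrite h subnn.
    rewrite nth_default ?[RHS]nth_default //; first exact: ltnW.
    by rewrite /= subn_gt0.
  have upE : (uphalf (size p)).*2 = (size p).+1.
    by rewrite uphalf_half op; have := odd_double_half (size p); rewrite op; lia.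
  have memp (k : 'I_(uphalf (size p)).*2) : val k != size p -> nth d p k \in p.
    move=> kp; apply: mem_nth; have := leq_trans (ltn_ord k) (eq_leq upE).
    by rewrite ltnS leq_eqVlt (negbTE kp).
  rewrite !nthE; case: eqP => [ip|/eqP ip]; case: eqP => [jp|/eqP jp] //.
  + by rewrite ip jp !(nth_default _ (leqnn _)) !bvv.
  + by rewrite ip (nth_default _ (leqnn _)) beta_skew [RHS]beta_skew ped // memp.
  + by rewrite jp (nth_default _ (leqnn _)) ped // memp.
have up1 : uphalf (size p).+1 = (uphalf (size p)).+1.
  by rewrite /= uphalf_half (negbTE op).
have -> : gram_pf d (p ++ [:: e]) = gram_pf d (p ++ [:: e; d]).
  have up2 : uphalf (size (p ++ [:: e; d])) = uphalf (size p).+1.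
    by rewrite size_cat /= addn2 /= uphalf_half (negbTE op).
  rewrite /gram_pf up2 sz; congr pfaffian; apply/matrixP => i j; rewrite !mxE.
  have nthE k : nth d (p ++ [:: e; d]) k = nth d (p ++ [:: e]) k.
    by rewrite !nth_cat; case: ifP => // _; case: (k - size p)%N => [|[|n]] //=; rewrite !nth_nil.
  by rewrite !nthE.
have -> : gram_pf d (p ++ [:: e; d]) = gram_pf d (p ++ [:: e; d - e]).
  have := gram_pf_linear d (p ++ [:: e]) (-1) e d [::].
  rewrite -!catA /= scaleN1r (addrC (- e)) => ->.
  by rewrite -[[:: e; e]]/(e :: e :: [::]) gram_pf_alternating mulr0 add0r.
have pE : (uphalf (size p)).*2 = size p.
  by rewrite uphalf_half (negbTE op); have := odd_double_half (size p); rewrite (negbTE op); lia.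
have sz2 : size (p ++ [:: e; d - e]) = (size p).+2 by rewrite size_cat addn2.
have nth0 : nth d (p ++ [:: e; d - e]) (size p) = e by rewrite nth_cat ltnn subnn.
have nth1 : nth d (p ++ [:: e; d - e]) (size p).+1 = d - e.
  by rewrite nth_cat ltnNge leqnSn /= subSnn.
have nth2 i : (i < size p)%N -> nth d (p ++ [:: e; d - e]) i = nth d p i.
  by move=> h; rewrite nth_cat h.
rewrite /gram_pf.
have -> : uphalf (size (p ++ [:: e; d - e])) = (uphalf (size p)).+1.
  by rewrite sz2.
have bde v : beta v (d - e) = beta v d - beta v e.
  by rewrite -[d - e]addrC -scaleN1r beta_linearr mulN1r addrC.
have ltp (i : 'I_(uphalf (size p)).*2) : (i < size p)%N.
  by apply: leq_trans (ltn_ord i) _; rewrite pE.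
apply: pfaffian_last => [i j|i j|i|]; rewrite !mxE ?lift_max.
- exact: beta_skew.
- by rewrite !nth2.
- rewrite -[nat_of_ord ord_max]/((uphalf (size p)).*2.+1) pE nth1 nth2 //.
  by rewrite bde ped ?subrr // mem_nth.
- rewrite -[X in nth _ _ X]/((uphalf (size p)).*2) pE nth0.
  rewrite -[nat_of_ord ord_max]/((uphalf (size p)).*2.+1) pE nth1.
  by rewrite bde ed bvv subr0.
Qed.

End GramPfaffian.

(** * Strict partitions with bounded parts and horizontal strips *)

Fixpoint strict_upto k : seq (seq nat) :=
  if k is k'.+1 then strict_upto k' ++ [seq k :: s | s <- strict_upto k']
  else [:: [::]].

Definition add_part (l : bool) k (s : seq nat) := if l then k :: s else s.

Lemma big_strict_uptoS (R : nmodType) k (F : seq nat -> R) :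
  \sum_(s <- strict_upto k.+1) F s =
  \sum_(s <- strict_upto k) F s + \sum_(s <- strict_upto k) F (k.+1 :: s).
Proof. by rewrite /= big_cat big_map. Qed.

Lemma strict_uptoSP k s : reflect
  (exists l s', s' \in strict_upto k /\ s = add_part l k.+1 s')
  (s \in strict_upto k.+1).
Proof.
rewrite /= mem_cat; apply: (iffP orP) => [[h|/mapP[s' h ->]]|[[] [s' [h ->]]]].
- by exists false, s.
- by exists true, s'.
- by right; apply: map_f.
- by left.
Qed.

Lemma strict_uptoE k s :
  (s \in strict_upto k) = is_strict_partition s && (head 0 s <= k)%N.
Proof.
elim: k s => [|k IH] s.
  case: s => [|a s] //=; rewrite inE /=.
  by case: a => [|a]; rewrite /is_strict_partition ?andbF //= inE eqxx /= andbF.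
rewrite /= mem_cat IH; apply/idP/idP.
  case/orP => [/andP[-> /leqW]//|/mapP[s' + ->]].
  rewrite IH => /andP[/andP[so n0] h]; rewrite /is_strict_partition /= leqnn andbT.
  rewrite inE n0 andbT; case: s' so n0 h => [|b s'] //= -> _ h.
  by rewrite andbT.
case/andP => sp; rewrite leq_eqVlt => /orP[/eqP h|]; last by rewrite ltnS => ->; rewrite sp.
case: s sp h => [|a s] //= sp h; subst a; apply/orP; right.
apply: map_f; rewrite IH; move: sp; rewrite /is_strict_partition /= inE.
case/andP => so; rewrite negb_or => /andP[_ n0]; rewrite n0 (path_sorted so) /=.
by case: s so n0 => [|b s] //= /andP[].
Qed.

Lemma strict_upto_uniq k : uniq (strict_upto k).
Proof.
elim: k => //= k IH; rewrite cat_uniq IH map_inj_uniq ?IH ?andbT; last by move=> a b [].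
apply/hasPn => _ /mapP[s _ ->]; rewrite strict_uptoE negb_and -ltnNge /=.
by rewrite ltnS leqnn orbT.
Qed.

Lemma strict_upto_head k s : s \in strict_upto k -> (head 0 s <= k)%N.
Proof. by rewrite strict_uptoE => /andP[]. Qed.

Lemma strict_upto_le k n s : (k <= n)%N -> s \in strict_upto k -> s \in strict_upto n.
Proof. by move=> kn; rewrite !strict_uptoE => /andP[-> /leq_trans ->]. Qed.

Section StripWeight.
Variable R : comPzRingType.
Implicit Types (x b : R) (lam mu : seq nat).

(** A horizontal strip lam/mu is read from its largest possible part down. The
    carry c is the number of parts of lam minus the number of parts of mu among
    the sites already read; lam and mu interlace when it stays in {0, 1}. The
    booleans l and m tell whether the current site is a part of lam, of mu. *)
Definition site_weight x (c l m : bool) : R :=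
  if c then (if l then (if m then x else 0) else (if m then 2 else x))
  else (if l then (if m then 1 else x) else (if m then 0 else 1)).

(** This is Q_{lam/mu}(x) for b = 2 and P_{lam/mu}(x) for b = 1: a final carry
    means that lam has one more part than mu. *)
Fixpoint strip_weight b x k (c : bool) lam mu : R :=
  if k is k'.+1 then
    let l := head 0%N lam == k in let m := head 0%N mu == k in
    site_weight x c l m *
    strip_weight b x k' (c (+) l (+) m)
      (if l then behead lam else lam) (if m then behead mu else mu)
  else if c then b else 1.

Lemma add_partE l k s : s \in strict_upto k ->
  (head 0%N (add_part l k.+1 s) == k.+1) = l /\
  (if l then behead (add_part l k.+1 s) else add_part l k.+1 s) = s.
Proof.
move=> /strict_upto_head h; case: l => /=; split => //; first by rewrite eqxx.
by apply/negbTE; rewrite neq_ltn ltnS h.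
Qed.

Lemma strip_weightS b x k c l m lam mu :
  lam \in strict_upto k -> mu \in strict_upto k ->
  strip_weight b x k.+1 c (add_part l k.+1 lam) (add_part m k.+1 mu) =
  site_weight x c l m * strip_weight b x k (c (+) l (+) m) lam mu.
Proof.
by move=> /(add_partE l)[h1 h2] /(add_partE m)[h3 h4] /=; rewrite h1 h2 h3 h4.
Qed.

End StripWeight.

Section Branching.
Variables (K : numFieldType) (V : lmodType K) (beta : V -> V -> K).
Hypothesis beta_linearl : forall a u v w,
  beta (a *: u + v) w = a * beta u w + beta v w.
Hypothesis beta_skew : forall u v, beta u v = - beta v u.
Variables (x : K) (e : nat -> V) (einf : V).
Hypothesis e0_inf : beta (e 0%N) einf = 1.
Hypothesis e_inf : forall r, (0 < r)%N -> beta (e r) (e 0%N) = beta (e r) einf.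

(** tvec r is e r plus the 2x^(r-u) e u for u < r: the coefficients are those of
    (1 + xz)/(1 - xz). Doubling the leading one gives gvec r = e r + tvec r, and
    then the part of tvec r below r is a multiple of gvec r.-1. *)
Fixpoint gvec k : V :=
  if k is k'.+1 then 2 *: e k + x *: gvec k' else 2 *: e 0%N.

Definition tvec k : V := if k is k'.+1 then x *: gvec k' + e k else e 0%N.

Lemma gvecE k : gvec k = e k + tvec k.
Proof. by case: k => [|k] /=; rewrite scaler_nat mulr2n // -addrA [e _ + (_ + _)]addrC addrA. Qed.

Let pf l := gram_pf beta einf l.

(** The vector gvec k is the remainder of a part of lam larger than k that has
    not met its part of mu yet. When k is a part of lam too, gvec k may be
    replaced with e k, as they differ by tvec k, the next vector of the list.
    So no vector is expanded beyond the next part of lam, and only the mu that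
    interlace with lam appear. *)
Lemma gram_pf_branching k c lam p :
  lam \in strict_upto k -> 0%N \notin p ->
  pf ([seq e i | i <- p] ++ (if c then [:: gvec k] else [::]) ++
      [seq tvec i | i <- lam]) =
  \sum_(mu <- strict_upto k)
    strip_weight 2 x k c lam mu * pf ([seq e i | i <- p ++ mu]).
Proof.
elim: k c lam p => [|k IH] c lam p.
  rewrite inE => /eqP -> p0 /=; rewrite big_seq1 /= !cats0.
  case: c; last by rewrite cats0 mul1r.
  rewrite /pf (gram_pf_linearZ beta_linearl beta_skew); congr (_ * _).
  apply: gram_pf_rcons => // _ /mapP[r rp ->]; apply: e_inf.
  by rewrite lt0n; apply: contraNneq p0 => <-.
have lin := gram_pf_linear beta_linearl beta_skew einf.
have linZ := gram_pf_linearZ beta_linearl beta_skew einf.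
case/strict_uptoSP => l [lam' [lam_k ->]] p0.
have pk : 0%N \notin rcons p k.+1 by rewrite mem_rcons inE negb_or p0.
have IHe c' : pf ([seq e i | i <- rcons p k.+1] ++
    (if c' then [:: gvec k] else [::]) ++ [seq tvec i | i <- lam']) =
    \sum_(mu <- strict_upto k) strip_weight 2 x k c' lam' mu *
      pf ([seq e i | i <- p ++ k.+1 :: mu]).
  by rewrite IH //; apply: eq_bigr => mu _; rewrite cat_rcons.
have stepW m c' : c' = c (+) l (+) m ->
  \sum_(mu <- strict_upto k) strip_weight 2 x k.+1 c (add_part l k.+1 lam')
     (add_part m k.+1 mu) * pf ([seq e i | i <- p ++ add_part m k.+1 mu]) =
  site_weight x c l m * \sum_(mu <- strict_upto k) strip_weight 2 x k c' lam' mu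
      * pf ([seq e i | i <- p ++ add_part m k.+1 mu]).
  move=> ->; rewrite mulr_sumr; apply: eq_big_seq => mu mu_k.
  by rewrite strip_weightS // mulrA.
rewrite big_strict_uptoS (stepW false _ erefl) (stepW true _ erefl) /=.
rewrite -IH // -IHe /pf {stepW IHe}.
have ekc q (l' : seq V) : [seq e i | i <- rcons q k.+1] ++ l' =
    [seq e i | i <- q] ++ e k.+1 :: l' by rewrite map_rcons cat_rcons.
case: c; case: l => /=; rewrite ?mul0r ?add0r ?mul1r ?addr0 ?ekc //.
- have -> : 2 *: e k.+1 + x *: gvec k = 1 *: e k.+1 + tvec k.+1.
    by rewrite scale1r -gvecE.
  rewrite lin gram_pf_alternating // addr0 mul1r.
  have := lin ([seq e i | i <- rcons p k.+1]) x (gvec k) (e k.+1)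
               [seq tvec i | i <- lam'].
  by rewrite !ekc gram_pf_alternating // addr0.
- by rewrite lin linZ addrC.
Qed.

End Branching.

(** * One-variable branching of Schur Q-functions *)

Section PolyForm.
Variable K : numFieldType.

Definition poly_functional (c : nat -> K) (p : {poly K}) : K :=
  \sum_(i < size p) p`_i * c i.

Lemma poly_functional_widen c (p : {poly K}) n : (size p <= n)%N ->
  poly_functional c p = \sum_(i < n) p`_i * c i.
Proof.
move=> pn; rewrite /poly_functional -!(big_mkord xpredT (fun i => p`_i * c i)).
rewrite [RHS](@big_cat_nat _ _ _ (size p)) //= [X in _ + X]big1_seq ?addr0 //.
by move=> i /andP[_]; rewrite mem_index_iota => /andP[h _]; rewrite nth_default ?mul0r.
Qed.

Lemma poly_functional_linear c a (p r : {poly K}) :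
  poly_functional c (a *: p + r) = a * poly_functional c p + poly_functional c r.
Proof.
pose n := maxn (size (a *: p + r)) (maxn (size p) (size r)).
rewrite !(@poly_functional_widen c _ n) ?leq_max ?leqnn ?orbT //.
rewrite mulr_sumr -big_split /=; apply: eq_bigr => i _.
by rewrite coefD coefZ mulrDl mulrA.
Qed.

Lemma poly_functionalXn c n : poly_functional c 'X^n = c n.
Proof.
rewrite /poly_functional size_polyXn big_ord_recr /= coefXn eqxx mul1r.
rewrite big1 ?add0r // => i _; rewrite coefXn.
by have := ltn_ord i; case: ltngtP => //; rewrite mul0r.
Qed.

Definition poly_form (F : nat -> nat -> K) (p r : {poly K}) : K :=
  poly_functional (fun i => poly_functional (F i) r) p.

Lemma poly_form_linearl F a u v w :
  poly_form F (a *: u + v) w = a * poly_form F u w + poly_form F v w.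
Proof. exact: poly_functional_linear. Qed.

Lemma poly_form_skew F : (forall i j, F i j = - F j i) ->
  forall u v, poly_form F u v = - poly_form F v u.
Proof.
move=> skew u v; rewrite /poly_form /poly_functional -sumrN.
under eq_bigr do rewrite mulr_sumr; rewrite exchange_big /=.
apply: eq_bigr => i _; rewrite mulr_sumr -sumrN; apply: eq_bigr => j _.
by rewrite skew !mulrN mulrCA.
Qed.

Lemma poly_formXn F i j : poly_form F 'X^i 'X^j = F i j.
Proof. by rewrite /poly_form !poly_functionalXn. Qed.

End PolyForm.

Section QRecursion.
Variable K : numFieldType.
Implicit Types (A B : seq K) (x : K) (M : nat -> nat -> K).

Lemma q_row0 A : q_row A 0 = 1.
Proof. by elim: A => [|a A IH] //=; rewrite big_ord1 /= mul1r IH. Qed.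

Lemma q_row_consS x B r :
  q_row (x :: B) r.+1 = x * q_row (x :: B) r + q_row B r.+1 + x * q_row B r.
Proof.
have qE n : q_row (x :: B) n = \sum_(i < n.+1) q1_coef x i * q_row B (n - i) by [].
rewrite !qE big_ord_recl /= mul1r subn0.
rewrite [X in _ + X]big_ord_recl [X in x * X]big_ord_recl /= /bump /= mul1r.
rewrite !subn0 subSS subn0.
set S1 := \sum_(i < r) _; set S2 := \sum_(i < r) _.
have -> : S1 = x * S2.
  rewrite mulr_sumr; apply: eq_bigr => i _.
  by rewrite !add1n subSS exprS; ring.
by ring.
Qed.

Lemma Q2_r0 A r : Q2 A r 0 = q_row A r.
Proof. by rewrite /Q2 q_row0 mulr1 big_geq // mulr0 addr0. Qed.

Lemma Q2_rec A r s :
  Q2 A r s.+1 + Q2 A r.+1 s = q_row A r * q_row A s.+1 - q_row A r.+1 * q_row A s.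
Proof.
rewrite /Q2 big_nat_recl // expr1 addn1 subSS subn0.
have -> : \sum_(1 <= i < s.+1) (-1) ^+ i.+1 * q_row A (r + i.+1) * q_row A (s.+1 - i.+1)
   = - \sum_(1 <= i < s.+1) (-1) ^+ i * q_row A (r.+1 + i) * q_row A (s - i).
  rewrite -sumrN; apply: eq_bigr => i _.
  by rewrite exprS addnS addSn subSS; ring.
by ring.
Qed.

(** The coefficients of (z - w)/(z + w) (q(z) q(w) - 1) extend the two-row
    functions antisymmetrically to all pairs of indices. They are described by
    the recursion that clears the denominator z + w. *)
Definition is_q_gram A M : Prop :=
  [/\ forall r s, M r s = - M s r,
      forall r, M r 0%N = q_row A r - (r == 0%N)%:R &
      forall r s, M r s.+1 + M r.+1 s =
        q_row A r * q_row A s.+1 - q_row A r.+1 * q_row A s].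

Lemma is_q_gramQ2 A M r s : is_q_gram A M -> (0 < r)%N -> M r s = Q2 A r s.
Proof.
case=> _ M0 Mrec; elim: s r => [|s IH] r r_gt0.
  by rewrite Q2_r0 M0 eqn0Ngt r_gt0 subr0.
by apply: (addIr (M r.+1 s)); rewrite Mrec {1}IH // Q2_rec.
Qed.

(** Index 0 stands for the padding vector and index u.+1 for the vector e u. *)
Definition extend_gram A M (i j : nat) : K :=
  match i, j with
  | 0, 0 => 0
  | 0, v.+1 => - q_row A v
  | u.+1, 0 => q_row A u
  | u.+1, v.+1 => M u v
  end.

Lemma extend_gram_skew A M : is_q_gram A M ->
  forall i j, extend_gram A M i j = - extend_gram A M j i.
Proof. by case=> skew _ _ [|u] [|v] //=; rewrite ?oppr0 ?opprK. Qed.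

Section OneVariable.
Variables (x : K) (B : seq K) (M : nat -> nat -> K).
Hypothesis M_gram : is_q_gram B M.

Local Notation beta := (poly_form (extend_gram B M)).
Local Notation e := (fun u : nat => 'X^(u.+1) : {poly K}).
Local Notation einf := ('X^0 : {poly K}).
Local Notation t := (tvec x e).
Local Notation q := (q_row B).
Local Notation q' := (q_row (x :: B)).
Local Notation f := (q1_coef x).

Let betaL a u v w : beta (a *: u + v) w = a * beta u w + beta v w.
Proof. exact: poly_form_linearl. Qed.

Let beta_skew u v : beta u v = - beta v u.
Proof. by apply: poly_form_skew; exact: extend_gram_skew. Qed.

Let betaR a u v w : beta w (a *: u + v) = a * beta w u + beta w v.
Proof. exact: beta_linearr. Qed.

Let tS k : t k.+1 = x *: t k + (x *: e k + e k.+1).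
Proof. by rewrite /= gvecE scalerDr addrCA addrA. Qed.

Let fS r : f r.+1 = x * f r + (r == 0%N)%:R * x.
Proof. by case: r => [|r] /=; rewrite ?mul0r ?addr0 ?exprS; ring. Qed.

Lemma beta_t_inf r : beta (t r) einf = q' r.
Proof.
elim: r => [|r IH]; first by rewrite poly_formXn [extend_gram _ _ _ _]/= !q_row0.
by rewrite tS !betaL IH !poly_formXn q_row_consS /=; ring.
Qed.

Let beta_t_e0 r : beta (t r) (e 0%N) = q' r - f r.
Proof.
have [_ M0 _] := M_gram.
elim: r => [|r IH]; first by rewrite poly_formXn [extend_gram _ _ _ _]/= M0 !q_row0.
rewrite tS !betaL IH !poly_formXn q_row_consS fS /= !M0 /=.
by rewrite mulr0n; ring.
Qed.

Let beta_e_t r s :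
  beta (e r) (t s.+1) + beta (e r.+1) (t s) =
  q r * q' s.+1 - (r == 0%N)%:R * f s.+1 - q r.+1 * q' s.
Proof.
have [_ M0 Mrec] := M_gram.
have MS u v : M u v.+1 = q u * q v.+1 - q u.+1 * q v - M u.+1 v.
  by rewrite -Mrec addrK.
elim: s => [|s IH].
  rewrite tS !betaR !poly_formXn /= -/(q_row (x :: B) 1) -/(q_row (x :: B) 0).
  rewrite q_row_consS !q_row0 MS !M0 /= q_row0.
  by case: r => [|r] /=; rewrite ?mulr0n; ring.
have E : beta (e r) (t s.+2) + beta (e r.+1) (t s.+1) =
   x * (beta (e r) (t s.+1) + beta (e r.+1) (t s)) +
   x * (M r s.+1 + M r.+1 s) + (M r s.+2 + M r.+1 s.+1).
  by rewrite [t s.+2]tS [t s.+1]tS !betaR !poly_formXn /=; ring.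
rewrite E IH !Mrec (q_row_consS x B s.+1) (fS s.+1) (q_row_consS x B s) /=.
by rewrite mulr0n mul0r addr0; ring.
Qed.

(** The terms in f are those of (z - w) f(z) f(w); they cancel for r, s > 0. *)
Let beta_t_t r s :
  beta (t r) (t s.+1) + beta (t r.+1) (t s) =
  q' r * q' s.+1 - q' r.+1 * q' s - f r * f s.+1 + f r.+1 * f s.
Proof.
elim: r => [|r IH].
  have E : beta (t 0%N) (t s.+1) + beta (t 1%N) (t s) =
     beta (e 0%N) (t s.+1) + beta (e 1%N) (t s) - 2 * x * beta (t s) (e 0%N).
    by rewrite [t 1%N]tS !betaL /= [beta (tvec _ _ s) _]beta_skew; ring.
  rewrite E beta_e_t beta_t_e0 !q_row0 (q_row_consS x B 0) !q_row0 /= expr1.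
  by ring.
have E : beta (t r.+1) (t s.+1) + beta (t r.+2) (t s) =
   x * (beta (t r) (t s.+1) + beta (t r.+1) (t s)) +
   x * (beta (e r) (t s.+1) + beta (e r.+1) (t s)) +
   (beta (e r.+1) (t s.+1) + beta (e r.+2) (t s)).
  by rewrite [t r.+2]tS [t r.+1]tS !betaL /=; ring.
rewrite E IH !beta_e_t (q_row_consS x B r.+1) (fS r.+1) (q_row_consS x B r) (fS r) /=.
by rewrite mulr0n !mul0r; ring.
Qed.

Let M' r s := beta (t r) (t s) + f r * (s == 0%N)%:R - f s * (r == 0%N)%:R.

(** With f(z) = (1 + xz)/(1 - xz), replacing q with f q turns the generating
    series M(z, w) into f(z) f(w) M(z, w) + f(z) - f(w). *)
Lemma is_q_gram_cons : is_q_gram (x :: B) M'.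
Proof.
split=> [r s|r|r s]; rewrite /M'.
- by rewrite beta_skew; ring.
- by rewrite [t 0%N]/= beta_t_e0 /=; ring.
have -> : beta (t r) (t s.+1) = q' r * q' s.+1 - q' r.+1 * q' s - f r * f s.+1 +
    f r.+1 * f s - beta (t r.+1) (t s) by rewrite -beta_t_t addrK.
by case: r => [|r]; case: s => [|s] /=; rewrite ?exprS; ring.
Qed.

Lemma beta_tE r s : (0 < r)%N -> (0 < s)%N -> beta (t r) (t s) = Q2 (x :: B) r s.
Proof.
move=> r0 s0; rewrite -(is_q_gramQ2 s is_q_gram_cons r0) /M'.
by rewrite !eqn0Ngt r0 s0 !mulr0 addr0 subr0.
Qed.

Lemma schurQ_gram_pf A (v : nat -> {poly K}) lam :
  (forall r s, (0 < r)%N -> (0 < s)%N -> beta (v r) (v s) = Q2 A r s) ->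
  (forall r, (0 < r)%N -> beta (v r) einf = q_row A r) ->
  is_strict_partition lam ->
  schurQ lam A = gram_pf beta einf [seq v i | i <- lam].
Proof.
move=> vv vinf /andP[lam_sorted lam0].
have pos i : (i < size lam)%N -> (0 < nth 0 lam i)%N.
  by move=> h; rewrite lt0n; apply: contraNneq lam0 => <-; rewrite mem_nth.
have upper (i j : nat) : (i < j)%N -> (j < (uphalf (size lam)).*2)%N ->
   Q2 A (nth 0%N lam i) (nth 0%N lam j) =
   beta (nth einf [seq v k | k <- lam] i) (nth einf [seq v k | k <- lam] j).
  move=> ij jn; have il : (i < size lam)%N.
    by move: jn; rewrite uphalf_half; have := odd_double_half (size lam); lia.
  rewrite (nth_map 0%N) //; case: (ltnP j (size lam)) => jl.
    by rewrite (nth_map 0%N) // vv // pos.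
  by rewrite (nth_default 0%N jl) (nth_default einf) ?size_map // Q2_r0 vinf ?pos.
rewrite /schurQ /gram_pf size_map; congr pfaffian; apply/matrixP => i j; rewrite !mxE.
case: ltngtP => ij; first by rewrite upper.
  by rewrite upper // -beta_skew.
rewrite ij; apply/eqP; rewrite eq_sym.
by rewrite -[_ == 0](mulrn_eq0 _ 2) mulr2n {1}beta_skew addNr.
Qed.

End OneVariable.

Lemma q_gram_exists A : exists M, is_q_gram A M.
Proof.
elim: A => [|x A [M hM]]; last by eexists; exact: (is_q_gram_cons x hM).
exists (fun _ _ => 0); split=> [r s|r|r s] /=; rewrite ?oppr0 ?subrr //.
by rewrite addr0 mulr0 mul0r subr0.
Qed.

Theorem schurQ_branching x B k lam : lam \in strict_upto k ->
  schurQ lam (x :: B) =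
  \sum_(mu <- strict_upto k) strip_weight 2 x k false lam mu * schurQ mu B.
Proof.
move=> lam_k; have [M hM] := q_gram_exists B.
have [_ M0 _] := hM.
pose beta := poly_form (extend_gram B M).
pose e u : {poly K} := 'X^(u.+1).
have bL a u v w : beta (a *: u + v) w = a * beta u w + beta v w.
  exact: poly_form_linearl.
have bS u v : beta u v = - beta v u.
  by apply: poly_form_skew; exact: extend_gram_skew.
have strict n s : s \in strict_upto n -> is_strict_partition s.
  by rewrite strict_uptoE => /andP[].
rewrite (@schurQ_gram_pf B M hM (x :: B) (tvec x e)) ?(strict k) //; first last.
- by move=> r r0; exact: beta_t_inf.
- by move=> r s r0 s0; exact: beta_tE.
have := @gram_pf_branching K _ beta bL bS x e 'X^0.
move=> /(_ _ _ k false lam [::] lam_k isT) ->.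
- apply: eq_big_seq => mu mu_k /=; congr (_ * _).
  rewrite (@schurQ_gram_pf B M hM B e) ?(strict k) // => r.
    by move=> s r0 s0; rewrite poly_formXn /= (is_q_gramQ2 s hM).
  by move=> r0; rewrite poly_formXn.
- by rewrite /beta poly_formXn /= q_row0.
- by move=> r r0; rewrite /beta !poly_formXn /= M0 eqn0Ngt r0 subr0.
Qed.

End QRecursion.

(** * Linear independence of Schur Q-functions *)

Section LinearIndependence.
Variable K : numFieldType.

Lemma strip_weight_horner (a : K) k c lam mu :
  (strip_weight 2 'X k c lam mu).[a] = strip_weight 2 a k c lam mu.
Proof.
have two : (2 : {poly K}) = 2%:P by rewrite polyC_natr.
elim: k c lam mu => [|k IH] c lam mu /=; first by case: c; rewrite ?two hornerC.
rewrite hornerM IH; congr (_ * _).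
by case: c; case: (_ == _); case: (_ == _) => /=; rewrite ?two ?hornerX ?hornerC.
Qed.

Lemma add_part_eq l m k s s' : s \in strict_upto k -> s' \in strict_upto k ->
  (add_part l k.+1 s == add_part m k.+1 s') = (l == m) && (s == s').
Proof.
move=> /strict_upto_head hs /strict_upto_head hs'; case: l m => [] [] //=.
- by rewrite eqseq_cons eqxx.
- by apply/negbTE/eqP => h; rewrite -h /= ltnn in hs'.
- by apply/negbTE/eqP => h; rewrite h /= ltnn in hs.
Qed.

(** Each site contributes at most one factor x. Starting from carry 1, all of
    them do so only if the carry never changes, that is if lam = mu. *)
Lemma coef_strip_weight k c lam mu :
  lam \in strict_upto k -> mu \in strict_upto k ->
  (size (strip_weight 2 'X k c lam mu : {poly K}) <= k.+1)%N /\
  (c -> (strip_weight 2 'X k c lam mu : {poly K})`_k = 2 * (lam == mu)%:R).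
Proof.
have two : (2 : {poly K}) = 2%:P by rewrite polyC_natr.
have site_size (c' l m : bool) : (size (site_weight 'X c' l m : {poly K}) <= 2)%N.
  case: c'; case: l; case: m => /=;
    rewrite ?size_polyX ?size_poly0 ?two ?size_poly1 //;
    by apply: leq_trans (size_polyC_leq1 _) _.
elim: k c lam mu => [|k IH] c lam mu.
  rewrite !inE => /eqP -> /eqP -> /=; case: c; rewrite ?two ?size_polyC_leq1.
    by split => // _; rewrite ?eqxx mulr1 coefC.
  by split.
case/strict_uptoSP => l [lam' [lk ->]] /strict_uptoSP [m [mu' [mk ->]]].
rewrite strip_weightS // add_part_eq //.
have [IHs IHc] := IH (c (+) l (+) m) lam' mu' lk mk.
split.
  apply: leq_trans (size_polyMleq _ _) _.
  by have := site_size c l m; move: IHs; lia.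
case: c IHs IHc => // IHs IHc _.
move: IHs IHc; case: l; case: m => /= IHs IHc.
- by rewrite mulrC coefMX /= IHc.
- by rewrite mul0r coef0 mulr0.
- by rewrite mulr_natl coefMn nth_default // mul0rn mulr0.
- by rewrite mulrC coefMX /= IHc.
Qed.

Lemma poly_eq0_horner (p : {poly K}) : (forall a, p.[a] = 0) -> p = 0.
Proof.
move=> p0; apply: (@roots_geq_poly_eq0 _ _ [seq i%:R | i <- iota 0 (size p)]).
- by apply/allP => a _; rewrite rootE p0.
- rewrite map_inj_uniq ?iota_uniq // => i j /eqP; rewrite eqr_nat; exact/eqP.
- by rewrite size_map size_iota.
Qed.

Lemma schurQ_nil A : schurQ [::] A = 1 :> K.
Proof.
rewrite /schurQ pfaffianE expr0 fact0 mul1r invr1 mul1r.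
rewrite (eq_bigr (fun _ => 1)) => [|s _].
  by rewrite sumr_const card_Sn.
rewrite /pf_term big_ord0 mulr1 (_ : s = 1%g) ?odd_perm1 //.
by apply/permP => -[].
Qed.

(** The part of Q_mu(x, B) of degree N+1 in x is 2 Q_mu'(B) when mu is mu' with
    a part N+1 added, and 0 when the parts of mu are at most N. *)
Lemma schurQ_free N (coef : seq nat -> K) :
  (forall B, \sum_(mu <- strict_upto N) coef mu * schurQ mu B = 0) ->
  forall mu, mu \in strict_upto N -> coef mu = 0.
Proof.
elim: N coef => [|N IH] coef sum0 mu.
  rewrite inE => /eqP ->; have := sum0 [::].
  by rewrite big_seq1 schurQ_nil mulr1.
have top mu' : mu' \in strict_upto N -> coef (N.+1 :: mu') = 0.
  apply: (IH (fun nu => coef (N.+1 :: nu))) => B {mu mu'}.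
  pose W mu nu : {poly K} := strip_weight 2 'X N.+1 false mu nu.
  pose p := \sum_(mu <- strict_upto N.+1) \sum_(nu <- strict_upto N.+1)
     (coef mu * schurQ nu B) *: W mu nu.
  have p0 : p = 0.
    apply: poly_eq0_horner => a; rewrite /p horner_sum -[RHS](sum0 (a :: B)).
    apply: eq_big_seq => mu mu_N; rewrite (schurQ_branching _ _ mu_N) mulr_sumr.
    rewrite horner_sum; apply: eq_bigr => nu _.
    by rewrite hornerZ strip_weight_horner; ring.
  have coefW l m mu nu : mu \in strict_upto N -> nu \in strict_upto N ->
      (W (add_part l N.+1 mu) (add_part m N.+1 nu))`_N.+1 =
      2 * [&& l, ~~ m & mu == nu]%:R.
    move=> mu_N nu_N; rewrite /W strip_weightS //.
    have [sz cf] := coef_strip_weight (false (+) l (+) m) mu_N nu_N.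
    case: l m sz cf => [] [] /= sz cf.
    - by rewrite mul1r nth_default // mulr0.
    - by rewrite mulrC coefMX /= cf.
    - by rewrite mul0r coef0 mulr0.
    - by rewrite mul1r nth_default // mulr0.
  have := congr1 (fun r : {poly K} => r`_N.+1) p0.
  rewrite coef0 /p coef_sum big_strict_uptoS.
  rewrite [X in X + _]big1_seq ?add0r => [|mu /andP[_ mu_N]]; last first.
    rewrite coef_sum big_strict_uptoS !big1_seq ?addr0 // => nu /andP[_ nu_N].
      by rewrite coefZ (coefW false true) //= !mulr0.
    by rewrite coefZ (coefW false false) //= !mulr0.
  move=> sum2; apply: (@mulfI _ 2); rewrite ?pnatr_eq0 // mulr0 -[RHS]sum2.
  rewrite mulr_sumr; apply: eq_big_seq => mu mu_N.
  rewrite coef_sum big_strict_uptoS [X in _ = _ + X]big1_seq ?addr0; last first.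
    by move=> nu /andP[_ nu_N]; rewrite coefZ (coefW true true) //= !mulr0.
  rewrite (bigD1_seq mu) ?strict_upto_uniq //= big1_seq ?addr0; last first.
    move=> nu /andP[nu_mu nu_N]; rewrite coefZ (coefW true false) //=.
    by rewrite eq_sym (negbTE nu_mu) !mulr0.
  by rewrite coefZ (coefW true false) //= eqxx mulr1 mulrC.
case/strict_uptoSP => [[] [mu' [mu'_N ->]]]; first exact: top.
apply: IH mu'_N => B; rewrite -[RHS](sum0 B) big_strict_uptoS.
by rewrite [X in _ + X]big1_seq ?addr0 // => nu /andP[_ /top ->]; rewrite mul0r.
Qed.

End LinearIndependence.

(** * Skew Schur Q-functions *)

Section SkewQ.
Variable R : comNzRingType.
Implicit Types (b x : R) (A : seq R).

Lemma strip_weight_stable b x k n lam mu : (k <= n)%N ->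
  lam \in strict_upto k -> mu \in strict_upto k ->
  strip_weight b x n false lam mu = strip_weight b x k false lam mu.
Proof.
move=> /subnKC <- lam_k mu_k; elim: (n - k)%N => [|i IH]; first by rewrite addn0.
rewrite addnS -IH.
have h s : s \in strict_upto k -> s \in strict_upto (k + i).
  by apply: strict_upto_le; rewrite leq_addr.
by rewrite (@strip_weightS _ b x _ false false false) ?h // mul1r.
Qed.

Lemma part_sub_trans mu nu lam : part_sub mu nu -> part_sub nu lam -> part_sub mu lam.
Proof. by move=> h1 h2 i; exact: leq_trans (h1 i) (h2 i). Qed.

Lemma part_sub_cons a a' mu lam :
  (a <= a')%N -> part_sub mu lam -> part_sub (a :: mu) (a' :: lam).
Proof. by move=> aa' h [|i] /=. Qed.

Lemma strip_weight_sub b x k (c : bool) lam mu a : (k < a)%N ->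
  lam \in strict_upto k -> mu \in strict_upto k ->
  strip_weight b x k c lam mu != 0 ->
  part_sub mu (if c then a :: lam else lam).
Proof.
elim: k c lam mu a => [|k IH] c lam mu a ka.
  by rewrite !inE => /eqP -> /eqP -> _ i; rewrite nth_nil; case: c.
case/strict_uptoSP => l [lam' [lk ->]] /strict_uptoSP [m [mu' [mk ->]]].
rewrite strip_weightS //.
have ka' : (k < a)%N by exact: ltnW.
have := IH (c (+) l (+) m) lam' mu' _ _ lk mk.
case: c; case: l; case: m => /= IHk;
  rewrite ?mul0r ?eqxx // => nz.
- apply: part_sub_cons; first exact: ltnW.
  by apply: (IHk k.+1) => //; apply: contraNneq nz => ->; rewrite mulr0.
- apply: part_sub_cons; first exact: ltnW.
  by apply: (IHk k.+1) => //; apply: contraNneq nz => ->; rewrite mulr0.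
- by apply: IHk => //; apply: contraNneq nz => ->; rewrite mulr0.
- apply: part_sub_cons => //.
  by apply: (IHk k.+1) => //; apply: contraNneq nz => ->; rewrite mulr0.
- by apply: IHk => //; apply: contraNneq nz => ->; rewrite mulr0.
- by apply: (IHk k.+1) => //; apply: contraNneq nz => ->; rewrite mulr0.
Qed.

(** The branching iterated over A; every bound N on the parts of lam gives the
    same value (skewQ_upto_stable). *)
Fixpoint skewQ_upto N A lam mu : R :=
  if A is x :: A' then
    \sum_(nu <- strict_upto N) strip_weight 2 x N false lam nu * skewQ_upto N A' nu mu
  else (lam == mu)%:R.

Lemma skewQ_upto_sub N A lam mu : lam \in strict_upto N ->
  ~ part_sub mu lam -> skewQ_upto N A lam mu = 0.
Proof.
move=> lam_N; elim: A lam lam_N => [|x A IH] lam lam_N nsub /=.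
  by case: eqP => // e; case: nsub; rewrite e.
rewrite big1_seq // => nu /andP[_ nu_N].
have [->|nz] := eqVneq (strip_weight 2 x N false lam nu) 0; first by rewrite mul0r.
rewrite IH ?mulr0 // => sub; apply: nsub; apply: part_sub_trans sub _.
exact: (strip_weight_sub (ltnSn N) lam_N nu_N nz).
Qed.

Lemma skewQ_upto_notin N A lam mu : lam \in strict_upto N ->
  mu \notin strict_upto N -> skewQ_upto N A lam mu = 0.
Proof.
move=> lam_N mu_N; elim: A lam lam_N => [|x A IH] lam lam_N /=.
  by case: eqP => // e; rewrite -e lam_N in mu_N.
by rewrite big1_seq // => nu /andP[_ /IH ->]; rewrite mulr0.
Qed.

Lemma skewQ_upto_stable k n A lam mu : (k <= n)%N -> lam \in strict_upto k ->
  skewQ_upto n A lam mu = skewQ_upto k A lam mu.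
Proof.
move=> /subnKC <-; elim: (n - k)%N => [|i IHi]; first by rewrite addn0.
move=> lam_k; rewrite -IHi // addnS {IHi}; move: (k + i)%N (leq_addr i k) => {i n} n kn.
have {kn} : lam \in strict_upto n by exact: strict_upto_le lam_k.
elim: A lam {lam_k} => [|x A IH] lam lam_n //.
have skewE k' : skewQ_upto k' (x :: A) lam mu = \sum_(nu <- strict_upto k')
  strip_weight 2 x k' false lam nu * skewQ_upto k' A nu mu by [].
rewrite !skewE big_strict_uptoS [X in _ + X]big1_seq ?addr0.
  apply: eq_big_seq => nu nu_n; rewrite IH //.
  by rewrite -(strip_weight_stable 2 x (leqnSn n)).
move=> nu /andP[_ nu_n].
by rewrite (@strip_weightS _ 2 x n false false true) //= !mul0r.
Qed.

End SkewQ.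

Section SkewSchurQ.
Variable K : numFieldType.

Lemma schurQ_cat N A B lam : lam \in strict_upto N ->
  schurQ lam (A ++ B) =
  \sum_(mu <- strict_upto N) skewQ_upto N A lam mu * schurQ mu B :> K.
Proof.
elim: A lam => [|x A IH] lam lam_N /=.
  rewrite (bigD1_seq lam) ?strict_upto_uniq //= eqxx mul1r big1 ?addr0 // => mu.
  by rewrite eq_sym => /negbTE ->; rewrite mul0r.
rewrite (schurQ_branching _ _ lam_N).
under [RHS]eq_bigr do rewrite mulr_suml; rewrite exchange_big /=.
apply: eq_big_seq => nu nu_N; rewrite IH // mulr_sumr.
by apply: eq_bigr => mu _; rewrite mulrA.
Qed.

Definition strict_partitions_upto N : seq strict_partition :=
  pmap insub (strict_upto N).

Lemma map_strict_partitions N :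
  [seq parts s | s <- strict_partitions_upto N] = strict_upto N.
Proof.
rewrite /strict_partitions_upto (pmap_filter (insubK _)); apply/all_filterP.
by apply/allP => s; rewrite strict_uptoE => /andP[sp _]; rewrite insubT.
Qed.

Lemma mem_strict_partitions N (s : strict_partition) :
  (s \in strict_partitions_upto N) = (parts s \in strict_upto N).
Proof. by rewrite -map_strict_partitions mem_map //; exact: val_inj. Qed.

Lemma strict_partitions_uniq N : uniq (strict_partitions_upto N).
Proof.
by apply: (@map_uniq _ _ parts); rewrite map_strict_partitions strict_upto_uniq.
Qed.

Lemma strict_partition_upto (s : strict_partition) N : (head 0 s <= N)%N ->
  parts s \in strict_upto N.
Proof. by move=> h; rewrite strict_uptoE h partsP. Qed.

Lemma part_sub_upto (lam mu : strict_partition) N :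
  parts lam \in strict_upto N -> part_sub mu lam -> parts mu \in strict_upto N.
Proof.
move=> /strict_upto_head lam_N sub; apply: strict_partition_upto.
by have := sub 0%N; rewrite !nth0 => /leq_trans ->.
Qed.

Lemma fsbig_part_sub (lam : strict_partition) N (F : strict_partition -> K) :
  parts lam \in strict_upto N -> (forall mu : strict_partition, ~ part_sub mu lam -> F mu = 0) ->
  \sum_(mu \in [set mu : strict_partition | part_sub mu lam]) F mu =
  \sum_(mu <- strict_partitions_upto N) F mu.
Proof.
move=> lam_N F0; rewrite (fsbig_seq _ _ (strict_partitions_uniq N)).
apply: fsbig_widen => mu /=; first by rewrite mem_strict_partitions; exact: part_sub_upto.
by move=> [_ nsub]; exact: F0.
Qed.

Definition skewQ (lam mu : strict_partition) (A : seq K) : K :=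
  skewQ_upto (head 0 lam) A lam mu.

Lemma skewQ_is_skew : is_skew_schurQ skewQ.
Proof.
split=> [lam A B|lam mu A nsub]; last first.
  by apply: skewQ_upto_sub => //; exact: strict_partition_upto.
have lam_N := strict_partition_upto (leqnn (head 0 lam)).
rewrite (fsbig_part_sub lam_N) => [|mu nsub]; last first.
  by rewrite /skewQ skewQ_upto_sub // mul0r.
by rewrite (schurQ_cat _ _ lam_N) -map_strict_partitions big_map.
Qed.

Lemma is_skew_schurQ_unique S S' :
  @is_skew_schurQ K S -> is_skew_schurQ S' ->
  forall lam mu A, S lam mu A = S' lam mu A.
Proof.
move=> [S1 S2] [S1' S2'] lam mu A.
have [sub|nsub] := pselect (part_sub mu lam); last by rewrite S2 ?S2'.
pose N := head 0%N lam; have lam_N := strict_partition_upto (leqnn N).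
pose coef s := if insub s is Some nu then S lam nu A - S' lam nu A else 0.
have coefE (nu : strict_partition) : coef nu = S lam nu A - S' lam nu A.
  by rewrite /coef valK.
apply/eqP; rewrite -subr_eq0 -coefE; apply/eqP.
apply: (@schurQ_free K N); last exact: part_sub_upto sub.
move=> B; rewrite -map_strict_partitions big_map.
under eq_bigr do rewrite coefE mulrBl.
rewrite sumrB -!(fsbig_part_sub lam_N) -?S1 -?S1' ?subrr // => nu nsub.
- by rewrite S2' // mul0r.
- by rewrite S2 // mul0r.
Qed.

Lemma skew_schurQE (lam mu : strict_partition) (A : seq K) N :
  parts lam \in strict_upto N -> skew_schurQ lam mu A = skewQ_upto N A lam mu.
Proof.
move=> lam_N; have h : is_skew_schurQ (@skew_schurQ K).
  by apply: (@xgetPex _ _ [set S | is_skew_schurQ S]); exists skewQ; exact: skewQ_is_skew.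
rewrite (is_skew_schurQ_unique h skewQ_is_skew) /skewQ.
rewrite -(@skewQ_upto_stable _ (head 0%N lam) N) //; first exact: strict_upto_head.
exact: strict_partition_upto.
Qed.

End SkewSchurQ.

(** * Commutation of up and down strips *)

Section YangBaxter.
Variables (K : realFieldType) (x y : K).
Let p := x * y.

Definition up_down k c d mu nu : K :=
  \sum_(lam <- strict_upto k)
    strip_weight 2 x k c lam mu * strip_weight 1 y k d lam nu.

Definition down_up k c d mu nu : K :=
  \sum_(tau <- strict_upto k)
    strip_weight 2 x k c nu tau * strip_weight 1 y k d mu tau.

Lemma up_downS k c d m n mu nu : mu \in strict_upto k -> nu \in strict_upto k ->
  up_down k.+1 c d (add_part m k.+1 mu) (add_part n k.+1 nu) =
  site_weight x c false m * site_weight y d false n * up_down k (c (+) m) (d (+) n) mu nu +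
  site_weight x c true m * site_weight y d true n *
    up_down k (~~ (c (+) m)) (~~ (d (+) n)) mu nu.
Proof.
move=> mu_k nu_k; rewrite /up_down big_strict_uptoS !mulr_sumr.
congr (_ + _); apply: eq_big_seq => lam lam_k.
  by rewrite (@strip_weightS _ 2 x _ c false) // (@strip_weightS _ 1 y _ d false) // !addbF mulrACA.
rewrite (@strip_weightS _ 2 x _ c true) // (@strip_weightS _ 1 y _ d true) //.
by rewrite !addbT !addNb mulrACA.
Qed.

Lemma down_upS k c d m n mu nu : mu \in strict_upto k -> nu \in strict_upto k ->
  down_up k.+1 c d (add_part m k.+1 mu) (add_part n k.+1 nu) =
  site_weight x c n false * site_weight y d m false * down_up k (c (+) n) (d (+) m) mu nu +
  site_weight x c n true * site_weight y d m true *
    down_up k (~~ (c (+) n)) (~~ (d (+) m)) mu nu.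
Proof.
move=> mu_k nu_k; rewrite /down_up big_strict_uptoS !mulr_sumr.
congr (_ + _); apply: eq_big_seq => lam lam_k.
  by rewrite (@strip_weightS _ 2 x _ c n false) // (@strip_weightS _ 1 y _ d m false) // !addbF mulrACA.
rewrite (@strip_weightS _ 2 x _ c n true) // (@strip_weightS _ 1 y _ d m true) //.
by rewrite !addbT mulrACA.
Qed.

(** The difference c - d of the two carries changes from site to site as mu and
    nu prescribe, so only the two states with c = d can mix. The transfer matrices of
    up_down and down_up at a site are intertwined by
      ( 1-p   p  )
      (  4   p-1 )
    on the states (0, 0), (1, 1) and by 1 + p on (1, 0) and (0, 1). The vector
    (1, 2) of the final weights is an eigenvector for 1 + p. *)
Lemma up_down_intertwine k mu nu : mu \in strict_upto k -> nu \in strict_upto k ->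
  [/\ (1 - p) * up_down k false false mu nu + p * up_down k true true mu nu =
        (1 + p) * down_up k false false mu nu,
      4 * up_down k false false mu nu + (p - 1) * up_down k true true mu nu =
        (1 + p) * down_up k true true mu nu,
      (1 + p) * up_down k true false mu nu = (1 + p) * down_up k true false mu nu &
      (1 + p) * up_down k false true mu nu = (1 + p) * down_up k false true mu nu].
Proof.
elim: k mu nu => [|k IH] mu nu.
  rewrite !inE => /eqP -> /eqP ->; rewrite /up_down /down_up !big_seq1 /=.
  by split; ring.
case/strict_uptoSP => m [mu' [mk ->]] /strict_uptoSP [n [nu' [nk ->]]].
have [H1 H2 H3 H4] := IH _ _ mk nk.
rewrite !up_downS // !down_upS //.
move: H1 H2 H3 H4; rewrite /p.
case: m; case: n => /=.
all: set a := up_down k false false mu' nu'; set b := up_down k true true mu' nu'.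
all: set a' := down_up k false false mu' nu'; set b' := down_up k true true mu' nu'.
all: set u := up_down k true false mu' nu'; set v := up_down k false true mu' nu'.
all: set u' := down_up k true false mu' nu'; set v' := down_up k false true mu' nu'.
all: move=> H1 H2 H3 H4.
(* The goals are linear combinations of these multiples of the hypotheses. *)
all: have E1 : x * y * ((1 - x * y) * a + x * y * b) = x * y * ((1 + x * y) * a') by rewrite H1.
all: have E2 : x * y * (4 * a + (x * y - 1) * b) = x * y * ((1 + x * y) * b') by rewrite H2.
all: have E3 : x * ((1 + x * y) * u) = x * ((1 + x * y) * u') by rewrite H3.
all: have E4 : y * ((1 + x * y) * v) = y * ((1 + x * y) * v') by rewrite H4.
all: have E5 : x * x * y * ((1 + x * y) * u) = x * x * y *((1 + x * y) * u') by rewrite H3.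
all: have E6 : y * x * y * ((1 + x * y) * v) = y * x * y * ((1 + x * y) * v') by rewrite H4.
all: have E7 : x * ((1 + x * y) * v) = x * ((1 + x * y) * v') by rewrite H4.
all: have E8 : y * ((1 + x * y) * u) = y * ((1 + x * y) * u') by rewrite H3.
all: split; lra.
Qed.

End YangBaxter.

(** * Sums over all strict partitions *)

Section EsumTools.
Context {R : realType}.
Local Open Scope ereal_scope.

Lemma esumZl (T : choiceType) (c : R) (a : T -> \bar R) :
  (0 <= c)%R -> (forall t, 0 <= a t) ->
  \esum_(t in [set: T]) (c%:E * a t) = c%:E * \esum_(t in [set: T]) a t.
Proof.
move=> c0 a0; rewrite /esum -ereal_supZl //; last first.
  by apply/set0P; exists 0; exists set0; [exact: fsets_set0|rewrite fsbig_set0].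
congr ereal_sup; apply/seteqP; split => z /=.
  move=> [A AS <-]; exists (\sum_(i \in A) a i); first by exists A.
  by rewrite ge0_mule_fsumr.
move=> [_ [A AS <-] <-]; exists A => //.
by rewrite ge0_mule_fsumr.
Qed.

Lemma esum_exchange (T T' : choiceType) (a : T -> T' -> \bar R) :
  (forall i j, 0 <= a i j) ->
  \esum_(i in [set: T]) \esum_(j in [set: T']) a i j =
  \esum_(j in [set: T']) \esum_(i in [set: T]) a i j.
Proof.
move=> a0; rewrite !esum_esum //.
rewrite (@reindex_esum R _ _ ([set: T'] `*`` (fun _ => [set: T]))
  ([set: T] `*`` (fun _ => [set: T'])) (fun k => (k.2, k.1))) //.
split => [k _|[i j] [k l] _ _ /= [-> ->] //|[i j] _]; first by split.
by exists (j, i).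
Qed.

Lemma esum_exchange_mul (T T' : choiceType) (a : T -> R) (b : T -> T' -> R) (c : T' -> R) :
  (forall i, 0 <= a i)%R -> (forall i j, 0 <= b i j)%R -> (forall j, 0 <= c j)%R ->
  \esum_(i in [set: T]) ((a i)%:E * \esum_(j in [set: T']) (b i j * c j)%:E) =
  \esum_(j in [set: T']) ((c j)%:E * \esum_(i in [set: T]) (a i * b i j)%:E).
Proof.
move=> a0 b0 c0.
rewrite (@eq_esum _ _ _ _ (fun i => \esum_(j in [set: T']) (a i * (b i j * c j))%:E)).
  rewrite esum_exchange => [|i j]; last by rewrite lee_fin !mulr_ge0.
  apply: eq_esum => j _; rewrite -esumZl // => [|i]; last by rewrite lee_fin mulr_ge0.
  by apply: eq_esum => i _; rewrite -EFinM; congr (_%:E); ring.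
by move=> i _; rewrite -esumZl // => j; rewrite lee_fin mulr_ge0.
Qed.

End EsumTools.

Section EsumStrict.
Context {R : realType}.

Lemma esum_strict_partition (F : seq nat -> R) (l : R) :
  (forall s : strict_partition, 0 <= F s) ->
  (\sum_(s <- strict_upto n) F s) @[n --> \oo] --> l ->
  \esum_(s in [set: strict_partition]) (F s)%:E = l%:E.
Proof.
move=> F0 cvgF; pose S n := \sum_(s <- strict_upto n) F s.
have SE n : S n = \sum_(s <- strict_partitions_upto n) F s.
  by rewrite /S -map_strict_partitions big_map.
have F0' n s : s \in strict_upto n -> 0 <= F s.
  by rewrite strict_uptoE => /andP[sp _]; exact: (F0 (StrictPartition sp)).
have S_ndecr : {homo S : m n / (m <= n)%N >-> m <= n}.
  apply: homo_leq => // [a b c|n]; first exact: le_trans.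
  rewrite /S big_strict_uptoS lerDl big_seq sumr_ge0 // => s s_n.
  by apply: (F0' n.+1); apply/strict_uptoSP; exists true, s.
have Sfs n : (S n)%:E = (\sum_(s \in [set` strict_partitions_upto n]) (F s)%:E)%E.
  by rewrite SE -sumEFin (fsbig_seq _ _ (strict_partitions_uniq n)).
have S_le n : S n <= l.
  have <- : limn S = l by exact: cvg_lim.
  by apply: nondecreasing_cvgn_le => //; apply/cvg_ex; exists l.
apply/eqP; rewrite eq_le; apply/andP; split.
  apply: ge_ereal_sup => _ [A [finA _] <-].
  pose n := (\max_(s <- finmap.enum_fset (fset_set A)) head 0 (parts s))%N.
  have A_n : A `<=` [set` strict_partitions_upto n].
    move=> s As /=; rewrite mem_strict_partitions; apply: strict_partition_upto.
    apply: (@leq_bigmax_seq _ _ xpredT (fun s => head 0%N (parts s))) => //.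
    by rewrite in_fset_set // inE.
  apply: (@le_trans _ _ (S n)%:E); last by rewrite lee_fin.
  rewrite Sfs; apply: lee_fsum_nneg_subset => //; first exact: finite_seq.
    by move=> s; rewrite !inE; exact: A_n.
  by move=> s _; rewrite lee_fin.
have cvgS : (S n)%:E @[n --> \oo] --> l%:E by apply: cvg_EFin; [exact: nearW|exact: cvgF].
have <- : limn (EFin \o S) = l%:E by exact: cvg_lim.
apply: lime_le; first by apply/cvg_ex; exists l%:E.
apply: nearW => n /=; rewrite Sfs; apply: ereal_sup_ubound.
by exists [set` strict_partitions_upto n] => //; split => //; exact: finite_seq.
Qed.

Lemma esum_strict_upto N (F : seq nat -> R) :
  (forall s : strict_partition, 0 <= F s) ->
  (forall s : strict_partition, parts s \notin strict_upto N -> F s = 0) ->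
  \esum_(s in [set: strict_partition]) (F s)%:E = (\sum_(s <- strict_upto N) F s)%:E.
Proof.
move=> F0 F_N; apply: esum_strict_partition => //.
apply: cvg_near_cst.
exists N => // n /= /subnKC <-; elim: (n - N)%N => [|k IH]; first by rewrite addn0.
rewrite addnS big_strict_uptoS IH [X in _ + X]big1_seq ?addr0 // => s /andP[_ s_k].
have s_k1 : (N + k).+1 :: s \in strict_upto (N + k).+1.
  by apply/strict_uptoSP; exists true, s.
have := s_k1; rewrite strict_uptoE => /andP[sp _].
apply: (F_N (StrictPartition sp)); rewrite /= strict_uptoE negb_and /=.
by rewrite -ltnNge ltnS leq_addr orbT.
Qed.

End EsumStrict.

(** * Skew Cauchy identity *)

Lemma schurP_branching (K : numFieldType) x (B : seq K) k lam :
  lam \in strict_upto k ->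
  schurP lam (x :: B) =
  \sum_(mu <- strict_upto k) strip_weight 1 x k false lam mu * schurP mu B.
Proof.
have scale n (c : bool) l m : l \in strict_upto n -> m \in strict_upto n ->
    2 ^+ size m * strip_weight 2 x n c l m =
    2 ^+ (c + size l) * strip_weight 1 x n c l m.
  elim: n c l m => [|n IH] c l m.
    by rewrite !inE => /eqP -> /eqP -> /=; case: c; rewrite ?mulr1 ?mul1r.
  case/strict_uptoSP => b [l' [l'_n ->]] /strict_uptoSP [d [m' [m'_n ->]]].
  rewrite !strip_weightS //.
  have := IH (c (+) b (+) d) l' m' l'_n m'_n.
  case: c; case: b; case: d => /=; rewrite ?mul0r ?mulr0 //;
    rewrite ?add0n ?add1n ?exprS; set w2 := strip_weight 2 _ _ _ _ _ => IHn.
  - by transitivity (2 * x * (2 ^+ size m' * w2)); [ring|rewrite IHn; ring].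
  - by transitivity (2 * 2 * (2 ^+ size m' * w2)); [ring|rewrite IHn; ring].
  - by transitivity (x * (2 ^+ size m' * w2)); [ring|rewrite IHn; ring].
  - by transitivity (2 * (2 ^+ size m' * w2)); [ring|rewrite IHn; ring].
  - by transitivity (x * (2 ^+ size m' * w2)); [ring|rewrite IHn; ring].
  - by rewrite !mul1r IHn.
move=> lam_k; rewrite /schurP (schurQ_branching _ _ lam_k) mulr_sumr.
apply: eq_big_seq => mu mu_k; rewrite mulrA [RHS]mulrA; congr (_ * _).
have two n : (2 ^+ n : K) != 0 by rewrite expf_neq0 // pnatr_eq0.
apply: (mulfI (two (size lam))); rewrite mulVKf //.
apply: (mulfI (two (size mu))); rewrite scale // add0n.
by field; rewrite two.
Qed.

Section Strip.
Variable R : realType.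
Implicit Types (x y b : R) (lam mu nu : strict_partition) (X Y : seq R).

Definition strip b x (lam mu : seq nat) : R :=
  strip_weight b x (maxn (head 0%N lam) (head 0%N mu)) false lam mu.

Lemma stripE b x N (lam mu : seq nat) :
  lam \in strict_upto N -> mu \in strict_upto N ->
  strip b x lam mu = strip_weight b x N false lam mu.
Proof.
move=> lam_N mu_N.
rewrite /strip -(@strip_weight_stable _ b x _ N) //.
- by rewrite geq_max !strict_upto_head.
- by move: lam_N; rewrite !strict_uptoE => /andP[-> _]; rewrite leq_maxl.
- by move: mu_N; rewrite !strict_uptoE => /andP[-> _]; rewrite leq_maxr.
Qed.

Lemma strip_notin b x N lam mu : parts lam \in strict_upto N ->
  parts mu \notin strict_upto N -> strip b x lam mu = 0.
Proof.
move=> lam_N mu_N; apply/eqP; apply: contraNT mu_N => nz.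
apply: (part_sub_upto lam_N).
apply: (strip_weight_sub (ltnSn _) _ _ nz); apply: strict_partition_upto.
  exact: leq_maxl.
exact: leq_maxr.
Qed.

Lemma strip_weight_ge0 b x k c (lam mu : seq nat) : 0 <= b -> 0 <= x ->
  0 <= strip_weight b x k c lam mu.
Proof.
move=> b0 x0; elim: k c lam mu => [|k IH] c lam mu /=; first by case: c.
apply: mulr_ge0 => //.
by case: c; case: (_ == _); case: (_ == _).
Qed.

Lemma strip_ge0 b x (lam mu : seq nat) : 0 <= b -> 0 <= x -> 0 <= strip b x lam mu.
Proof. exact: strip_weight_ge0. Qed.

Lemma skewQ_upto_ge0 N X (lam mu : seq nat) :
  (forall x, x \in X -> 0 <= x) -> 0 <= skewQ_upto N X lam mu.
Proof.
elim: X lam => [|x X IH] lam X0 /=; first exact: ler0n.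
rewrite sumr_ge0 // => nu _; apply: mulr_ge0.
  by apply: strip_weight_ge0 => //; apply: X0; rewrite mem_head.
by apply: IH => z zX; apply: X0; rewrite inE zX orbT.
Qed.

Lemma schurQ_nil_alphabet (lam : strict_partition) :
  schurQ lam ([::] : seq R) = (parts lam == [::])%:R.
Proof.
case: eqP => [->|lam_nz]; first exact: schurQ_nil.
have Q2_0 r s : (0 < r)%N -> Q2 ([::] : seq R) r s = 0.
  by case: r => // r _; rewrite /Q2 /= mul0r big1 ?mulr0 ?addr0 // => i _; rewrite mulr0 mul0r.
have /andP[_ lam0] := partsP lam.
have pos i : (i < size lam)%N -> (0 < nth 0%N lam i)%N.
  by move=> h; rewrite lt0n; apply: contraNneq lam0 => <-; rewrite mem_nth.
rewrite /schurQ pfaffianE big1 ?mulr0 // => s _; rewrite /pf_term.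
have m0 : (0 < uphalf (size lam))%N by case: (parts lam) lam_nz.
rewrite (bigD1 (Ordinal m0)) //= mulrCA mxE [X in X * _](_ : _ = 0) ?mul0r //.
have half_lt (i j : 'I_(uphalf (size lam)).*2) : (i < j)%N -> (i < size lam)%N.
  move=> ij; apply: leq_trans ij _; rewrite -ltnS; apply: leq_trans (ltn_ord j) _.
  by rewrite uphalf_half; have := odd_double_half (size lam); lia.
case: (ltngtP (s (even_pos (Ordinal m0))) (s (odd_pos (Ordinal m0)))) => // h.
  by rewrite Q2_0 // pos // (half_lt _ _ h).
by rewrite Q2_0 ?oppr0 // pos // (half_lt _ _ h).
Qed.

Lemma schurQ_skewQ N (lam : strict_partition) X : parts lam \in strict_upto N ->
  schurQ lam X = skewQ_upto N X lam [::].
Proof.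
move=> lam_N; rewrite -[X in schurQ _ X]cats0 (schurQ_cat _ _ lam_N).
have nil_N : [::] \in strict_upto N by rewrite strict_uptoE.
rewrite (bigD1_seq [::]) ?strict_upto_uniq //= schurQ_nil mulr1.
rewrite big_seq_cond big1 ?addr0 // => mu /andP[mu_N mu_nz].
have := mu_N; rewrite strict_uptoE => /andP[sp _].
by rewrite (schurQ_nil_alphabet (StrictPartition sp)) /= (negbTE mu_nz) mulr0.
Qed.

Lemma schurQ_ge0 (lam : strict_partition) X :
  (forall x, x \in X -> 0 <= x) -> 0 <= schurQ lam X.
Proof.
move=> X0; rewrite (schurQ_skewQ _ (strict_partition_upto (leqnn (head 0%N lam)))).
exact: skewQ_upto_ge0.
Qed.

Lemma schurP_ge0 (lam : strict_partition) X :
  (forall x, x \in X -> 0 <= x) -> 0 <= schurP lam X.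
Proof. by move=> X0; rewrite mulr_ge0 ?invr_ge0 ?exprn_ge0 ?schurQ_ge0. Qed.

Definition cauchy_factor x y : R := (1 + x * y) / (1 - x * y).

(** Let p = xy and let N bound the parts of mu and nu. Above N the transfer
    matrices are explicit, and the sum S over the lam with parts at most n
    satisfies (1 - p) S = (1 + p) T - p^(n-N+1) E, where T is the sum over tau
    and E does not depend on n. *)
Lemma strip_commute x y mu nu : 0 <= x -> 0 <= y -> x * y < 1 ->
  \esum_(lam in [set: strict_partition]) (strip 2 x lam mu * strip 1 y lam nu)%:E =
  ((cauchy_factor x y)%:E *
   \esum_(tau in [set: strict_partition]) (strip 2 x nu tau * strip 1 y mu tau)%:E)%E.
Proof.
move=> x0 y0 xy1; have xy0 : 0 <= x * y by exact: mulr_ge0.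
pose N := maxn (head 0%N mu) (head 0%N nu).
have mu_N : parts mu \in strict_upto N.
  by apply: strict_partition_upto; exact: leq_maxl.
have nu_N : parts nu \in strict_upto N.
  by apply: strict_partition_upto; exact: leq_maxr.
pose T := down_up x y N false false mu nu; pose E := up_down x y N true true mu nu.
have up_N k s : s \in strict_upto N -> s \in strict_upto (k + N).
  by apply: strict_upto_le; exact: leq_addl.
have updE k : up_down x y (k + N) true true mu nu = (x * y) ^+ k * E /\
    (1 - x * y) * up_down x y (k + N) false false mu nu =
    (1 + x * y) * T - (x * y) ^+ k.+1 * E.
  elim: k => [|k [IH1 IH2]].
    have [<- _ _ _] := up_down_intertwine x y mu_N nu_N.
    by rewrite add0n expr0 expr1 mul1r addrK.
  rewrite addSn.
  rewrite !(@up_downS _ x y _ _ _ false false) ?up_N //= !mul0r addr0 !mul1r.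
  rewrite IH1; split; first by rewrite exprS; ring.
  by rewrite mulrDr IH2 !exprS; ring.
rewrite (@esum_strict_upto _ N (fun tau => strip 2 x nu tau * strip 1 y mu tau)); first last.
- by move=> tau /(strip_notin 2 x nu_N) ->; rewrite mul0r.
- by move=> tau; rewrite mulr_ge0 ?strip_ge0.
have -> : \sum_(s <- strict_upto N) strip 2 x nu s * strip 1 y mu s = T.
  by apply: eq_big_seq => s s_N; rewrite !(@stripE _ _ N).
rewrite -EFinM; apply: (@esum_strict_partition _
  (fun s => strip 2 x s mu * strip 1 y s nu)) => [lam|].
  by rewrite mulr_ge0 ?strip_ge0.
have p_neq : 1 - x * y != 0 by rewrite subr_eq0 eq_sym lt_eqF.
rewrite -(cvg_shiftn N).
rewrite (_ : (fun n => _) = fun n => cauchy_factor x y * T -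
    (x * y) ^+ n * (x * y * E / (1 - x * y))); last first.
  apply/funext => n; rewrite /=.
  rewrite (_ : \sum_(_ <- _) _ = up_down x y (n + N) false false mu nu).
    apply: (mulfI p_neq); rewrite (updE n).2 /cauchy_factor exprS.
    by field.
  have mu_nN := up_N n _ mu_N; have nu_nN := up_N n _ nu_N.
  by apply: eq_big_seq => s s_n; rewrite !(@stripE _ _ (n + N)).
have limE : cauchy_factor x y * T - 0 * (x * y * E / (1 - x * y)) =
    cauchy_factor x y * T by rewrite mul0r subr0.
rewrite -{2}limE.
apply: cvgB; first exact: cvg_cst.
by apply: cvgMl; apply: cvg_expr; rewrite ger0_norm.
Qed.

Definition cauchy_product X Y : R := \prod_(x <- X) \prod_(y <- Y) cauchy_factor x y.

Lemma cauchy_factor_ge0 x y : 0 <= x -> 0 <= y -> x * y < 1 -> 0 <= cauchy_factor x y.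
Proof.
move=> x0 y0 xy1; apply: divr_ge0; last by rewrite subr_ge0 ltW.
by rewrite addr_ge0 ?mulr_ge0.
Qed.

Lemma esum_schurP_cons y Y nu :
  (forall y', y' \in y :: Y -> 0 <= y') ->
  (schurP nu (y :: Y))%:E =
  \esum_(tau in [set: strict_partition]) (strip 1 y nu tau * schurP tau Y)%:E.
Proof.
move=> Y0; pose N := head 0%N nu.
have y0 : 0 <= y by apply: Y0; rewrite mem_head.
have Y0' z : z \in Y -> 0 <= z by move=> zY; apply: Y0; rewrite inE zY orbT.
have nu_N : parts nu \in strict_upto N by exact: strict_partition_upto.
rewrite (@esum_strict_upto _ N (fun tau => strip 1 y nu tau * schurP tau Y)); first last.
- by move=> tau /(strip_notin 1 y nu_N) ->; rewrite mul0r.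
- by move=> tau; rewrite mulr_ge0 ?strip_ge0 ?schurP_ge0.
rewrite (schurP_branching _ _ nu_N); congr (_%:E).
by apply: eq_big_seq => s s_N; rewrite (stripE _ _ nu_N).
Qed.

Lemma schurP_nil_alphabet lam : schurP lam ([::] : seq R) = (parts lam == [::])%:R.
Proof.
rewrite /schurP schurQ_nil_alphabet; case: eqP => [->|_]; last by rewrite mulr0.
by rewrite expr0 invr1 mulr1.
Qed.

(** By induction on Y: for each y of Y the strip added with x is moved through
    the strip removed with y. *)
Lemma skew_cauchy_variable x Y mu : 0 <= x ->
  (forall y, y \in Y -> 0 <= y) -> (forall y, y \in Y -> x * y < 1) ->
  \esum_(lam in [set: strict_partition]) (strip 2 x lam mu * schurP lam Y)%:E =
  ((\prod_(y <- Y) cauchy_factor x y)%:E * (schurP mu Y)%:E)%E.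
Proof.
move=> x0; elim: Y mu => [|y Y IH] mu Y0 xY1.
  rewrite big_nil mul1e.
  rewrite (@esum_strict_upto _ 0 (fun s => strip 2 x s mu * schurP s [::])); first last.
  - move=> lam; rewrite inE schurP_nil_alphabet => /negbTE ->; exact: mulr0.
  - by move=> lam; rewrite mulr_ge0 ?strip_ge0 ?schurP_ge0.
  have e0 : is_strict_partition [::] by [].
  rewrite big_seq1 (schurP_nil_alphabet (StrictPartition e0)) mulr1.
  rewrite schurP_nil_alphabet; congr (_%:E).
  case: eqP => [->|mu_nz]; first by rewrite /strip.
  apply: (@strip_notin 2 x 0 (StrictPartition e0)) => //.
  by rewrite inE; apply/eqP.
have y0 : 0 <= y by apply: Y0; rewrite mem_head.
have xy1 : x * y < 1 by apply: xY1; rewrite mem_head.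
have Y0' z : z \in Y -> 0 <= z by move=> zY; apply: Y0; rewrite inE zY orbT.
have xY1' z : z \in Y -> x * z < 1 by move=> zY; apply: xY1; rewrite inE zY orbT.
have c0 := cauchy_factor_ge0 x0 y0 xy1.
have cY0 : 0 <= \prod_(z <- Y) cauchy_factor x z.
  by rewrite big_seq; apply: prodr_ge0 => z zY; apply: cauchy_factor_ge0; auto.
under eq_esum => lam _ do rewrite EFinM (esum_schurP_cons _ Y0).
rewrite (@esum_exchange_mul _ _ _ (fun lam : strict_partition => strip 2 x lam mu)
  (fun lam nu : strict_partition => strip 1 y lam nu) (fun nu => schurP nu Y));
  [|by move=> *; rewrite ?strip_ge0 ?schurP_ge0..].
under eq_esum => nu _ do rewrite strip_commute // muleCA.
rewrite esumZl //; last first.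
  move=> nu; apply: mule_ge0; first by rewrite lee_fin schurP_ge0.
  by apply: esum_ge0 => tau _; rewrite lee_fin mulr_ge0 ?strip_ge0.
under eq_esum => nu _ do (under eq_esum => tau _ do rewrite mulrC).
rewrite -(@esum_exchange_mul _ _ _ (fun tau : strict_partition => strip 1 y mu tau)
  (fun tau nu : strict_partition => strip 2 x nu tau) (fun nu => schurP nu Y));
  [|by move=> *; rewrite ?strip_ge0 ?schurP_ge0..].
under eq_esum => tau _ do rewrite IH // muleCA.
rewrite esumZl //; last by move=> tau; rewrite mule_ge0 ?lee_fin ?strip_ge0 ?schurP_ge0.
by rewrite (esum_schurP_cons _ Y0) muleA -EFinM big_cons.
Qed.

Lemma esum_skewQ_cons x X lam mu :
  (forall z, z \in x :: X -> 0 <= z) ->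
  (skewQ lam mu (x :: X))%:E =
  \esum_(nu in [set: strict_partition]) (strip 2 x lam nu * skewQ nu mu X)%:E.
Proof.
move=> X0; pose N := head 0%N lam.
have x0 : 0 <= x by apply: X0; rewrite mem_head.
have X0' z : z \in X -> 0 <= z by move=> zX; apply: X0; rewrite inE zX orbT.
have lam_N : parts lam \in strict_upto N by exact: strict_partition_upto.
rewrite (@esum_strict_upto _ N
  (fun s => strip 2 x lam s * skewQ_upto (head 0%N s) X s mu)); first last.
- by move=> nu /(strip_notin 2 x lam_N) ->; rewrite mul0r.
- by move=> nu; rewrite mulr_ge0 ?strip_ge0 ?skewQ_upto_ge0.
rewrite /skewQ /=; congr (_%:E).
apply: eq_big_seq => s s_N; rewrite (stripE _ _ lam_N) //; congr (_ * _).
apply: skewQ_upto_stable; first exact: strict_upto_head s_N.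
by move: s_N; rewrite !strict_uptoE => /andP[-> _] /=.
Qed.

Theorem skew_cauchy X Y mu :
  (forall x, x \in X -> 0 <= x) -> (forall y, y \in Y -> 0 <= y) ->
  (forall x y, x \in X -> y \in Y -> x * y < 1) ->
  \esum_(lam in [set: strict_partition]) (skewQ lam mu X * schurP lam Y)%:E =
  (cauchy_product X Y * schurP mu Y)%:E.
Proof.
move=> X0 Y0; elim: X mu X0 => [|x X IH] mu X0 XY1.
  rewrite /cauchy_product big_nil mul1r.
  pose F s := (s == parts mu)%:R * schurP s Y.
  rewrite (@esum_strict_upto _ (head 0%N mu) F).
  - have mu_N : parts mu \in strict_upto (head 0%N mu) by exact: strict_partition_upto.
    rewrite (bigD1_seq (parts mu)) ?strict_upto_uniq //= /F eqxx mul1r big1 ?addr0 //.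
    by move=> s /negbTE ->; rewrite mul0r.
  - by move=> s; rewrite mulr_ge0 ?ler0n ?schurP_ge0.
  - move=> s; rewrite /F; case: eqP => [->|_]; last by rewrite mul0r.
    by rewrite strict_partition_upto.
have x0 : 0 <= x by apply: X0; rewrite mem_head.
have X0' z : z \in X -> 0 <= z by move=> zX; apply: X0; rewrite inE zX orbT.
have xY1 y : y \in Y -> x * y < 1 by apply: XY1; rewrite mem_head.
have XY1' z y : z \in X -> y \in Y -> z * y < 1.
  by move=> zX; apply: XY1; rewrite inE zX orbT.
have cY0 : 0 <= \prod_(y <- Y) cauchy_factor x y.
  by rewrite big_seq; apply: prodr_ge0 => z zY; apply: cauchy_factor_ge0; auto.
have sk0 lam nu : 0 <= skewQ lam nu X by exact: skewQ_upto_ge0.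
under eq_esum => lam _ do rewrite mulrC EFinM (esum_skewQ_cons _ _ X0).
rewrite (@esum_exchange_mul _ _ _ (fun lam : strict_partition => schurP lam Y)
  (fun lam nu : strict_partition => strip 2 x lam nu) (fun nu => skewQ nu mu X)) //;
  [|by move=> *; rewrite ?strip_ge0 ?schurP_ge0..].
under eq_esum => nu _ do (under eq_esum => lam _ do rewrite mulrC).
under eq_esum => nu _ do rewrite skew_cauchy_variable // muleCA.
rewrite esumZl // => [|nu]; last by rewrite mule_ge0 ?lee_fin ?schurP_ge0.
under eq_esum => nu _ do rewrite -EFinM.
by rewrite IH // -EFinM mulrA /cauchy_product big_cons.
Qed.

End Strip.

(** * The product formula for the kernel H *)

Section Kernel.
Variable R : realType.
Implicit Types (p t : R) (n : nat).

Definition odd_log_poly n : {poly R} :=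
  \sum_(1 <= i < n | odd i) (i%:R^-1 : R) *: 'X^i.

Lemma odd_log_poly_recr n :
  odd_log_poly n.+2 = odd_log_poly n.+1 + (if odd n.+1 then n.+1%:R^-1 *: 'X^(n.+1) else 0).
Proof. by rewrite /odd_log_poly big_mkcond big_nat_recr //= -big_mkcond. Qed.

Lemma horner_deriv_odd_log_poly n t :
  (1 - t ^+ 2) * (odd_log_poly n)^`().[t] = 1 - t ^+ (n./2).*2.
Proof.
case: n => [|n]; first by rewrite /odd_log_poly big_geq // deriv0 horner0 mulr0 expr0 subrr.
elim: n => [|n IH]; first by rewrite /odd_log_poly big_geq // deriv0 horner0 mulr0 expr0 subrr.
rewrite odd_log_poly_recr derivD hornerD mulrDr IH.
case: ifPn => on; last first.
  rewrite deriv0 horner0 mulr0 addr0; congr (_ - t ^+ _).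
  by move: on; rewrite /=; lia.
rewrite derivZ derivXn hornerZ hornerMn hornerXn /=.
have -> : n.+1%:R^-1 * (t ^+ n *+ n.+1) = t ^+ n.
  by rewrite -[t ^+ n *+ _]mulr_natr mulrCA mulVf ?mulr1 ?pnatr_eq0.
have -> : ((n.+2)./2).*2 = n.+2 by move: on => /=; lia.
have -> : ((n.+1)./2).*2 = n by move: on => /=; lia.
by rewrite !exprS; ring.
Qed.

(** As a function of p, the limit minus the n-th term vanishes at 0 and, with k
    the half of n, has derivative 2 t^(2k) / (1 - t^2) at t, so the mean value theorem bounds it by
    a constant times p^(2k). *)
Lemma cvg_odd_log_poly p : 0 <= p -> p < 1 ->
  (2 * (odd_log_poly n).[p]) @[n --> \oo] --> ln (1 + p) - ln (1 - p).
Proof.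
move=> p0 p1.
pose u : {poly R} := 1 + 'X; pose v : {poly R} := 1 - 'X.
pose D n : R -> R := ((@ln R \o horner u) - (@ln R \o horner v)) -
  horner (2%:P * odd_log_poly n).
have DE n t : D n t = ln (1 + t) - ln (1 - t) - 2 * (odd_log_poly n).[t].
  by rewrite /D /u /v !fctE /= !hornerE.
have sq_lt1 t : 0 <= t -> t <= p -> 0 < 1 - t ^+ 2.
  by move=> t0 tp; rewrite subr_gt0 expr_lt1 //; exact: le_lt_trans p1.
have Dder n t : 0 <= t -> t <= p ->
    is_derive t 1 (D n) (2 * (t ^+ (n./2).*2 / (1 - t ^+ 2))).
  move=> t0 tp; have t1 : t < 1 by exact: le_lt_trans p1.
  have u0 : 0 < u.[t] by rewrite /u !hornerE; lra.
  have v0 : 0 < v.[t] by rewrite /v !hornerE; lra.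
  have du := is_derive1_ln u0; have dv := is_derive1_ln v0.
  have := @is_deriveB _ _ _ _ _ _ _ _ _ (is_deriveB (is_derive1_comp du (is_derive_poly u t))
    (is_derive1_comp dv (is_derive_poly v t))) (is_derive_poly (2%:P * odd_log_poly n) t).
  move=> /is_derive_eq; apply.
  have -> : u.[t] = 1 + t by rewrite /u !hornerE.
  have -> : v.[t] = 1 - t by rewrite /v !hornerE.
  have -> : u^`().[t] = 1 by rewrite /u !(derivD, derivC, derivX) !hornerE.
  have -> : v^`().[t] = -1 by rewrite /v !(derivD, derivN, derivC, derivX) !hornerE.
  have -> : (2%:P * odd_log_poly n)^`().[t] = 2 * (odd_log_poly n)^`().[t].
    by rewrite derivM derivC mul0r add0r hornerM hornerC.
  have := horner_deriv_odd_log_poly n t; have := sq_lt1 t t0 tp.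
  set d := (_^`()).[t]; set m := t ^+ (n./2).*2 => h e.
  have -> : m = 1 - (1 - t ^+ 2) * d by rewrite e opprB addrC subrK.
  have n1 : 1 + t != 0 by rewrite gt_eqF //; lra.
  have n2 : 1 - t != 0 by rewrite gt_eqF //; lra.
  have n3 : 1 - t ^+ 2 != 0 by rewrite gt_eqF.
  by field; rewrite n1 n2 n3.
have bound n : 0 <= D n p <= 2 * p ^+ (n./2).*2 / (1 - p ^+ 2) * p.
  have [|c|c] := @MVT_segment _ (D n) (fun t => 2 * (t ^+ (n./2).*2 / (1 - t ^+ 2))) 0 p p0.
  - move=> t; rewrite in_itv /= => /andP[/ltW ? /ltW ?]; exact: Dder.
  - apply: derivable_within_continuous => t; rewrite in_itv /= => /andP[t0 tp].
    by have [] := Dder n t t0 tp.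
  rewrite in_itv /= => /andP[c0 cp].
  have D0 : D n 0 = 0.
    rewrite DE addr0 subr0 subrr sub0r /odd_log_poly horner_sum big1_seq ?mulr0 ?oppr0 // => i.
    by case: i => [|i] // _; rewrite hornerZ hornerXn expr0n mulr0.
  rewrite D0 subr0 => ->; rewrite subr0.
  have h1 := sq_lt1 c c0 cp; have h2 := sq_lt1 p p0 (lexx p).
  rewrite !mulr_ge0 ?exprn_ge0 ?invr_ge0 ?(ltW h1) //= ler_wpM2r //.
  rewrite -mulrA ler_wpM2l // ler_pM ?exprn_ge0 ?invr_ge0 ?(ltW h1) //.
    by rewrite lerXn2r.
  by rewrite lef_pV2 // lerD2l lerN2 lerXn2r.
have cvgD0 : D n p @[n --> \oo] --> 0.
  apply: (@squeeze_cvgr _ _ _ _ (cst 0) (fun n => p ^+ (n./2).*2 * (2 / (1 - p ^+ 2) * p))).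
  - by apply: nearW => n /=; have := bound n; rewrite [2 * _]mulrC !mulrA.
  - exact: cvg_cst.
  have half_oo : n./2 @[n --> \oo] --> \oo.
    by apply/cvgnyPge => A; exists A.*2 => //= n /=; lia.
  have sq0 : (p ^+ 2) ^+ k @[k --> \oo] --> 0.
    by apply: cvg_expr; rewrite ger0_norm ?exprn_ge0 // expr_lt1.
  have : (p ^+ 2) ^+ (k./2) * (2 / (1 - p ^+ 2) * p) @[k --> \oo] -->
      0 * (2 / (1 - p ^+ 2) * p) by apply: cvgMl; exact: (cvg_comp _ _ half_oo sq0).
  rewrite mul0r; apply: cvg_trans; apply: near_eq_cvg; apply: nearW => n /=.
  by rewrite -exprM mul2n.
rewrite (_ : (fun n => _) = fun n => (ln (1 + p) - ln (1 - p)) - D n p); last first.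
  by apply/funext => n; rewrite DE opprB addrC subrK.
rewrite -{2}[ln (1 + p) - ln (1 - p)]subr0.
by apply: cvgB => //; exact: cvg_cst.
Qed.

Lemma powersumM n (A B : seq R) :
  powersum n A * powersum n B = \sum_(a <- A) \sum_(b <- B) (a * b) ^+ n.
Proof.
rewrite /powersum mulr_suml; apply: eq_bigr => a _.
by rewrite mulr_sumr; apply: eq_bigr => b _; rewrite exprMn.
Qed.

Lemma cvg_sum_seq (T : eqType) (r : seq T) (f : T -> nat -> R) (l : T -> R) :
  (forall x, x \in r -> f x n @[n --> \oo] --> l x) ->
  (\sum_(x <- r) f x n) @[n --> \oo] --> \sum_(x <- r) l x.
Proof.
elim: r => [|x r IH] fl.
  by rewrite big_nil; under eq_fun do rewrite big_nil; exact: cvg_cst.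
rewrite big_cons; under eq_fun do rewrite big_cons.
apply: cvgD; first by apply: fl; rewrite mem_head.
by apply: IH => z zr; apply: fl; rewrite inE zr orbT.
Qed.

Lemma H_kernelE (A B : seq R) :
  (forall a, a \in A -> 0 <= a) -> (forall b, b \in B -> 0 <= b) ->
  (forall a b, a \in A -> b \in B -> a * b < 1) ->
  H_kernel A B = cauchy_product A B.
Proof.
move=> A0 B0 AB1; rewrite /H_kernel.
set S := fun n => \sum_(1 <= i < n | odd i) powersum i A * powersum i B / i%:R.
have SE n : 2 * S n = \sum_(a <- A) \sum_(b <- B) 2 * (odd_log_poly n).[a * b].
  rewrite /S mulr_sumr.
  under eq_bigr do rewrite powersumM mulr_suml mulr_sumr.
  rewrite exchange_big /=; apply: eq_bigr => a _.
  under eq_bigr do rewrite mulr_suml mulr_sumr.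
  rewrite exchange_big /=; apply: eq_bigr => b _.
  rewrite /odd_log_poly horner_sum mulr_sumr; apply: eq_bigr => i _.
  by rewrite hornerZ hornerXn [in RHS](mulrC i%:R^-1).
pose L := \sum_(a <- A) \sum_(b <- B) (ln (1 + a * b) - ln (1 - a * b)).
have cvg2S : 2 * S n @[n --> \oo] --> L.
  under eq_fun do rewrite SE.
  apply: cvg_sum_seq => a aA; apply: cvg_sum_seq => b bB.
  by apply: cvg_odd_log_poly; [rewrite mulr_ge0; auto | exact: AB1].
have cvgS : S n @[n --> \oo] --> L / 2.
  have : (2 * S n) * 2^-1 @[n --> \oo] --> L * 2^-1 by exact: cvgMl.
  apply: cvg_trans; apply: near_eq_cvg; apply: nearW => n /=.
  by rewrite mulrC mulKf.
have -> : limn S = L / 2 by exact: cvg_lim.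
rewrite mulrC mulfVK // expR_sum; apply: eq_big_seq => a aA.
rewrite expR_sum; apply: eq_big_seq => b bB.
have ab0 : 0 <= a * b by rewrite mulr_ge0; auto.
have ab1 := AB1 a b aA bB.
by rewrite expRB !lnK // posrE; lra.
Qed.

End Kernel.

(** * The measure and its marginals *)

Lemma weightE (R : realType) (q : R) (X Y : seq R) (mu lam : strict_partition) :
  weight q X Y mu lam =
  schurQ mu (dilate q X) * skewQ lam mu X * schurP lam Y /
    (H_kernel (dilate q X) Y * H_kernel X Y).
Proof.
rewrite /weight (@skew_schurQE _ lam mu X (head 0%N lam)); last first.
  exact: strict_partition_upto.
case: asboolP => // nsub.
by rewrite /skewQ skewQ_upto_sub ?mulr0 ?mul0r //; exact: strict_partition_upto.
Qed.

Theorem cauchy (R : realType) (A B : seq R) :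
  (forall a, a \in A -> 0 <= a) -> (forall b, b \in B -> 0 <= b) ->
  (forall a b, a \in A -> b \in B -> a * b < 1) ->
  \esum_(lam in [set: strict_partition]) (schurQ lam A * schurP lam B)%:E =
  (cauchy_product A B)%:E.
Proof.
move=> A0 B0 AB1; have e0 : is_strict_partition [::] by [].
have := skew_cauchy (StrictPartition e0) A0 B0 AB1.
rewrite /schurP /= expr0 invr1 mul1r schurQ_nil mulr1 => <-.
apply: eq_esum => lam _; rewrite /skewQ -schurQ_skewQ //; exact: strict_partition_upto.
Qed.

Theorem theorem4p3 (R : realType) (q : R) (X Y : seq R)
    (q_ge0 : 0 <= q)
    (X_ge0 : forall x, x \in X -> 0 <= x)
    (Y_ge0 : forall y, y \in Y -> 0 <= y)
    (XY_lt1 : forall x y, x \in X -> y \in Y -> Num.max 1 q * x * y < 1) :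
  [/\ is_prob_mass
        (fun p : strict_partition * strict_partition => weight q X Y p.1 p.2),
      forall lam : strict_partition,
        \esum_(mu in [set: strict_partition]) (weight q X Y mu lam)%:E =
        (schurQ lam (X ++ dilate q X) * schurP lam Y /
         H_kernel (X ++ dilate q X) Y)%:E
    & forall mu : strict_partition,
        \esum_(lam in [set: strict_partition]) (weight q X Y mu lam)%:E =
        (schurQ mu (dilate q X) * schurP mu Y / H_kernel (dilate q X) Y)%:E].
Proof.
pose qX := dilate q X.
have qX_ge0 a : a \in qX -> 0 <= a by case/mapP => x xX ->; rewrite mulr_ge0 // X_ge0.
have lt1 c x y : 0 <= c -> c <= Num.max 1 q -> x \in X -> y \in Y -> c * x * y < 1.
  move=> c0 cm xX yY; apply: le_lt_trans (XY_lt1 x y xX yY).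
  by rewrite ler_wpM2r ?Y_ge0 // ler_wpM2r ?X_ge0.
have XY1 x y : x \in X -> y \in Y -> x * y < 1.
  by move=> xX yY; rewrite -[x]mul1r lt1 // le_max lexx.
have qXY1 a y : a \in qX -> y \in Y -> a * y < 1.
  by case/mapP => x xX -> yY; rewrite lt1 // le_max lexx orbT.
have HX := H_kernelE X_ge0 Y_ge0 XY1.
have HqX := H_kernelE qX_ge0 Y_ge0 qXY1.
have Hcat : H_kernel (X ++ qX) Y = H_kernel X Y * H_kernel qX Y.
  rewrite HX HqX H_kernelE // /cauchy_product ?big_cat //.
    by move=> a; rewrite mem_cat => /orP[/X_ge0|/qX_ge0].
  by move=> a y; rewrite mem_cat => /orP[aX|aX] yY; [exact: XY1|exact: qXY1].
have HX_gt0 : 0 < H_kernel X Y by exact: expR_gt0.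
have HqX_gt0 : 0 < H_kernel qX Y by exact: expR_gt0.
have HX_neq0 := lt0r_neq0 HX_gt0; have HqX_neq0 := lt0r_neq0 HqX_gt0.
have HH_ge0 : 0 <= H_kernel qX Y * H_kernel X Y by rewrite mulr_ge0 ?ltW.
have sk0 lam mu : 0 <= skewQ lam mu X by exact: skewQ_upto_ge0.
have w_ge0 mu lam : 0 <= weight q X Y mu lam.
  by rewrite weightE divr_ge0 // mulr_ge0 ?schurP_ge0 // mulr_ge0 ?schurQ_ge0.
have mu_marginal (mu : strict_partition) :
    \esum_(lam in [set: strict_partition]) (weight q X Y mu lam)%:E =
    (schurQ mu qX * schurP mu Y / H_kernel qX Y)%:E.
  pose c := schurQ mu qX / (H_kernel qX Y * H_kernel X Y).
  have c0 : 0 <= c by rewrite divr_ge0 ?schurQ_ge0.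
  transitivity (c%:E * (cauchy_product X Y * schurP mu Y)%:E)%E; last first.
    rewrite -HX -EFinM /c; congr (_%:E); by field; rewrite HX_neq0 HqX_neq0.
  rewrite -skew_cauchy // -esumZl // => [|lam]; last first.
    by rewrite lee_fin mulr_ge0 ?schurP_ge0.
  by apply: eq_esum => lam _; rewrite weightE -EFinM /c; congr (_%:E); ring.
split=> //.
- split=> [[mu lam]|]; first exact: w_ge0.
  have -> : [set: strict_partition * strict_partition] =
      [set: strict_partition] `*`` (fun _ => [set: strict_partition]).
    by apply/seteqP; split => // k _; split.
  rewrite -(@esum_esum _ _ _ _ _ (fun mu lam => (weight q X Y mu lam)%:E)); last first.
    by move=> mu lam _ _; rewrite lee_fin.
  under eq_esum => mu _ do rewrite mu_marginal mulrC EFinM.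
  rewrite esumZl ?invr_ge0 ?(ltW HqX_gt0) // => [|mu]; last first.
    by rewrite lee_fin mulr_ge0 ?schurQ_ge0 ?schurP_ge0.
  by rewrite cauchy // -HqX -EFinM mulVf.
- move=> lam; pose N := head 0%N lam.
  have lam_N : parts lam \in strict_upto N by exact: strict_partition_upto.
  pose F s := schurQ s qX * skewQ_upto N X lam s * schurP lam Y /
    (H_kernel qX Y * H_kernel X Y).
  transitivity (\esum_(mu in [set: strict_partition]) (F mu)%:E).
    by apply: eq_esum => mu _; rewrite weightE.
  rewrite (@esum_strict_upto _ N F) => [|mu|mu mu_N]; last first.
  + by rewrite /F skewQ_upto_notin // mulr0 !mul0r.
  + by rewrite /F divr_ge0 // mulr_ge0 ?schurP_ge0 // mulr_ge0 ?schurQ_ge0 ?skewQ_upto_ge0.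
  congr (_%:E); rewrite /F -!mulr_suml Hcat (schurQ_cat _ _ lam_N).
  rewrite [H_kernel qX Y * _]mulrC; congr (_ * _ / _).
  by apply: eq_bigr => s _; rewrite mulrC.
Qed.
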